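(* (1) Let $\omega=e^{2\pi\mathrm{i}/3}$ and let $\wp$ be the Weierstrass function associated with the lattice $\mathbb{Z}+\mathbb{Z}\omega$. Then, as meromorphic functions of $z\in\mathbb{C}$, $$\wp\left((1+2\omega)z\right)-\wp\left(\tfrac12\right)+\frac{\wp\left(\frac{\omega}{2}\right)-\wp\left(\frac12\right)}{\omega-1}=\frac{4\left(\frac{\wp\left(\frac{\omega}{2}\right)-\wp\left(\frac12\right)}{\omega-1}\right)^3-\left(\wp(z)-\wp\left(\frac12\right)+\frac{\wp\left(\frac{\omega}{2}\right)-\wp\left(\frac12\right)}{\omega-1}\right)^3}{3\left(\wp(z)-\wp\left(\frac12\right)+\frac{\wp\left(\frac{\omega}{2}\right)-\wp\left(\frac12\right)}{\omega-1}\right)^2}.$$ (2) Let $\wp$ be the Weierstrass function associated with the lattice $\mathbb{Z}+\mathbb{Z}\mathrm{i}$. Then, as meromorphic functions of $z\in\mathbb{C}$, $$\wp\left((1+2\mathrm{i})z\right)=(-1+2\mathrm{i})^2\,\frac{\wp(z)\left(\wp(z)^2-(1+2\mathrm{i})\wp\left(\frac{\mathrm{i}}{2}\right)^2\right)^2}{\left(5\wp(z)^2-(1-2\mathrm{i})\wp\left(\frac{\mathrm{i}}{2}\right)^2\right)^2}.$$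
   Context: For a lattice $\Lambda\subset\mathbb{C}$, the Weierstrass function is $\wp(z)=\frac{1}{z^2}+\sum_{\lambda\in\Lambda\setminus\{0\}}\left(\frac{1}{(z-\lambda)^2}-\frac{1}{\lambda^2}\right)$. *)

(* Defs.v *)
From HB Require Import structures.
From mathcomp Require Import all_boot all_order all_algebra.
From mathcomp Require Import complex.
From mathcomp Require Import all_classical all_reals all_analysis.
From mathcomp Require Import summability.

Set Implicit Arguments.
Unset Strict Implicit.
Unset Printing Implicit Defensive.

Import Order.TTheory GRing.Theory Num.Theory numFieldNormedType.Exports.

Local Open Scope classical_set_scope.
Local Open Scope ring_scope.
Local Open Scope complex_scope.

(* The regular module R[i]^o is what carries the topology and the normed
   R[i]-module structure of the complex plane. *)
Notation "''CC[' R ]" := ((complex R)^o)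
  (at level 0, format "''CC[' R ]") : type_scope.

Definition imagu (R : realType) : 'CC[R] := 0 +i* 1.

Definition cexp (R : realType) (z : 'CC[R]) : 'CC[R] :=
  let: x +i* y := z in (expR x)%:C * (cos y +i* sin y).

Definition lattice (R : realType) (w1 w2 : 'CC[R]) : set 'CC[R] :=
  [set m%:~R * w1 + n%:~R * w2 | m in [set: int] & n in [set: int]].

(* [sum] is the limit of the finite partial sums along the directed set of
   finite subsets of the index type, i.e. the sum does not depend on any
   enumeration of the lattice.  Since 0^-1 = 0, the values at points of L are
   conventional. *)
Definition wp (R : realType) (L : set 'CC[R]) (z : 'CC[R]) : 'CC[R] :=
  1 / z ^+ 2
  + sum (fun l : L `\ 0 => 1 / (z - sval l) ^+ 2 - 1 / sval l ^+ 2 : 'CC[R]).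

(* [derivable] is taken over the scalar field R[i], so this is complex
   differentiability on a neighborhood of z0. *)
Definition holomorphic_near (R : realType) (f : 'CC[R] -> 'CC[R])
    (z0 : 'CC[R]) :=
  \forall z \near z0, derivable f z 1.

(* A meromorphic function is represented by a total function whose values at a
   closed discrete set of points (in particular at the poles) are irrelevant:
   only the germs on punctured neighborhoods z0^' matter. *)
Definition meromorphic (R : realType) (f : 'CC[R] -> 'CC[R]) :=
  forall z0 : 'CC[R], exists (n : nat) (h : 'CC[R] -> 'CC[R]),
    holomorphic_near h z0 /\
    (\forall z \near z0^', f z = h z / (z - z0) ^+ n).

Definition eq_meromorphic (R : realType) (f g : 'CC[R] -> 'CC[R]) :=
  [/\ meromorphic f, meromorphic g &
      forall z0 : 'CC[R], \forall z \near z0^', f z = g z].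

(* Main.v *)
(** Both formulas rest on Liouville's theorem for doubly periodic functions,
    which is obtained without integration. A function with an expansion
    f (z + h) = f z + b h + c h^2 + O(h^3) at every point satisfies the maximum
    principle, because averaging over z + h, z + i h, z - h, z - i h cancels the
    terms in h and h^2. Isolated points where f is merely bounded are removed by
    applying the principle to q^3 g^N, with q a polynomial vanishing at these
    points and g = (f - f z1) / (z - z1), and letting N tend to infinity.

    Let P be the Weierstrass function and e = P (1/2). For the Eisenstein
    integers and a = 1 + 2 omega, the relation P (omega z) = omega P z makes P
    vanish at the non-lattice points of a^-1 L and gives P z = z^-2 + O(z^4), so
    3 P(a z) P(z)^2 + P(z)^3 has no poles; its value at 1/2 is 4 e^3.

    For the Gaussian integers put t0 = (1 + i) / 2 and a = 1 + 2 i. The same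
    argument gives 2 i P((1 + i) z) P z = P(z)^2 - e^2 and
    P(z + t0) P(z) = - e^2; the first relation yields a P(z)^2 = e^2 at the
    non-lattice points of a^-1 L. Hence, for a suitable c,
    P(a z) P(z + t0) (a P(z)^2 - e^2)^2 + e^2 P(z)^4 + c e^2 P(z)^2
    is constant, and the values at 1/2 and t0 determine c and the constant. *)

Require Import Defs.
From HB Require Import structures.
From mathcomp Require Import all_boot all_order all_algebra.
From mathcomp Require Import complex.
From mathcomp Require Import all_classical all_reals all_analysis.
From mathcomp Require Import ring lra.
From mathcomp Require Import finmap summability.

Set Implicit Arguments.
Unset Strict Implicit.
Unset Printing Implicit Defensive.

Import Order.TTheory GRing.Theory Num.Theory numFieldNormedType.Exports.
Import Normc.

Local Open Scope classical_set_scope.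
Local Open Scope ring_scope.
Local Open Scope complex_scope.

(** Each identity is multiplied out before Liouville is applied, so that at an exceptional point
    only boundedness has to be checked: poles of one factor must meet zeros of another, or principal
    parts must cancel.

    The awkward case is a = 1 + 2 i. The expected relation P(a z) (a P^2 - e^2)^2 = P^5 - 2 a e^2
    P^3 + a^2 e^4 P has poles of order 10 at L, and matching the terms h^-10, h^-6, h^-2 would call
    for the coefficient of h^6 in P, which the symmetry under i does not give. The factor P(z + t0)
    = - e^2 / P(z) lowers the order by 2: only h^-8 and h^-4 are left to cancel, and the last
    coefficient becomes the constant of Liouville's theorem, to be read off at a point. This factor
    adds a pole at t0, but a t0 = t0 modulo L makes P(a z) vanish doubly there.

    The quotients are recovered at the end from P(1/2) <> 0: otherwise the identities would
    propagate zeros of P towards the pole at 0. *)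

Section ComplexModulus.
Variable R : realType.
Implicit Types (x y z : R[i]) (a b : R).

Lemma normc_ge0 x : 0 <= normc x.
Proof. by case: x => a b; exact: sqrtr_ge0. Qed.

Lemma normc_eq0 x : (normc x == 0) = (x == 0).
Proof. by apply/eqP/eqP => [/eq0_normc //|->]; rewrite normc0. Qed.

Lemma normc_gt0 x : (0 < normc x) = (x != 0).
Proof. by rewrite lt_def normc_ge0 andbT normc_eq0. Qed.

Lemma normcX x n : normc (x ^+ n) = normc x ^+ n.
Proof. by elim: n => [|n IH]; rewrite ?expr0 ?normc1 // !exprS normcM IH. Qed.

Lemma normc_dist x y : normc (x - y) = normc (y - x).
Proof. by rewrite -opprB normcN. Qed.

Lemma ler_normcD x y : normc (x + y) <= normc x + normc y.
Proof. exact: le_normcD. Qed.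

Lemma normc_triB x y : normc x - normc y <= normc (x + y).
Proof.
have := ler_normcD (x + y) (- y); rewrite addrK normcN; lra.
Qed.

Lemma normc_sqr x : normc x ^+ 2 = complex.Re x ^+ 2 + complex.Im x ^+ 2.
Proof. by case: x => a b /=; rewrite sqr_sqrtr // addr_ge0 // sqr_ge0. Qed.

Lemma normc_Re x : `|complex.Re x| <= normc x.
Proof.
case: x => a b /=; rewrite -sqrtr_sqr ler_sqrt ?addr_ge0 ?sqr_ge0 //.
by rewrite lerDl sqr_ge0.
Qed.

Lemma normc_Im x : `|complex.Im x| <= normc x.
Proof.
case: x => a b /=; rewrite -sqrtr_sqr ler_sqrt ?addr_ge0 ?sqr_ge0 //.
by rewrite lerDr sqr_ge0.
Qed.

Lemma normc_real a : normc a%:C = `|a|.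
Proof. by rewrite /= expr0n /= addr0 sqrtr_sqr. Qed.

Lemma normc_leD x : normc x <= `|complex.Re x| + `|complex.Im x|.
Proof.
rewrite -(ler_pXn2r (ltn0Sn 1)) ?nnegrE ?normc_ge0 ?addr_ge0 //.
rewrite normc_sqr sqrrD !real_normK ?num_real //.
have := mulr_ge0 (normr_ge0 (complex.Re x)) (normr_ge0 (complex.Im x)); lra.
Qed.

Lemma normc_nat n : normc (n%:R : R[i]) = n%:R.
Proof. by rewrite normcMn normc1. Qed.

Lemma normrc x : `|x| = (normc x)%:C.
Proof. by []. Qed.

Lemma ReD x y : complex.Re (x + y) = complex.Re x + complex.Re y.
Proof. by case: x y => [? ?] [? ?]. Qed.

Lemma ImD x y : complex.Im (x + y) = complex.Im x + complex.Im y.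
Proof. by case: x y => [? ?] [? ?]. Qed.

Lemma ReN x : complex.Re (- x) = - complex.Re x.
Proof. by case: x. Qed.

End ComplexModulus.

(** * Bounded remainders and finite expansions at a point *)

Section LocalExpansions.
Variable R : realType.
Local Notation C := R[i].
Implicit Types (f g r s : C -> C) (p q : {poly C}) (z h a w : C) (n : nat).

(** The value at h = 0 is left free, because at a singular point a total function takes a
    conventional value. *)
Definition near0_bounded g :=
  exists (M d : R), 0 < d /\
    forall h, h != 0 -> normc h < d -> normc (g h) <= M.

(* Expansion f(z0 + h) = p(h) + O(h^n) as h -> 0; the degree of [p] is not
   restricted, which makes stability under products immediate. *)
Definition expands n f z0 :=
  exists (p : {poly C}) (r : C -> C), near0_bounded r /\
    forall h, f (z0 + h) = p.[h] + r h * h ^+ n.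

Lemma near0_bounded_ex g : near0_bounded g ->
  exists (M d : R), [/\ 0 < d, 0 < M &
    forall h, h != 0 -> normc h < d -> normc (g h) <= M].
Proof.
move=> [M [d [d0 gM]]]; exists (`|M| + 1), d; split=> //.
by move=> h h0 /(gM h h0) /le_trans; apply; have := ler_norm M; lra.
Qed.

Lemma near0_bounded_cst a : near0_bounded (fun=> a).
Proof. by exists (normc a), 1; split. Qed.

Lemma near0_bounded_id : near0_bounded id.
Proof. by exists 1, 1; split => // h _ /ltW. Qed.

Lemma near0_boundedD f g : near0_bounded f -> near0_bounded g ->
  near0_bounded (fun h => f h + g h).
Proof.
move=> [M [d [d0 fM]]] [M' [d' [d'0 gM]]].
exists (M + M'), (Num.min d d'); split; first by rewrite lt_min d0.
move=> h h0; rewrite lt_min => /andP[hd hd'].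
by rewrite (le_trans (ler_normcD _ _)) // lerD ?fM ?gM.
Qed.

Lemma near0_boundedM f g : near0_bounded f -> near0_bounded g ->
  near0_bounded (fun h => f h * g h).
Proof.
move=> [M [d [d0 fM]]] [M' [d' [d'0 gM]]].
exists (M * M'), (Num.min d d'); split; first by rewrite lt_min d0.
move=> h h0; rewrite lt_min => /andP[hd hd'].
by rewrite normcM ler_pM ?normc_ge0 ?fM ?gM.
Qed.

Lemma near0_boundedN f : near0_bounded f -> near0_bounded (fun h => - f h).
Proof.
by move=> [M [d [d0 fM]]]; exists M, d; split=> // h; rewrite normcN; exact: fM.
Qed.

Lemma near0_boundedB f g : near0_bounded f -> near0_bounded g ->
  near0_bounded (fun h => f h - g h).
Proof. by move=> ? ?; apply: near0_boundedD => //; apply: near0_boundedN. Qed.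

Lemma near0_boundedX f n : near0_bounded f -> near0_bounded (fun h => f h ^+ n).
Proof.
move=> bf; elim: n => [|n IH]; first exact: near0_bounded_cst.
have [M [d [d0 fM]]] := near0_boundedM bf IH.
by exists M, d; split=> // h h0 hd; rewrite exprS; exact: fM.
Qed.

Lemma near0_bounded_near f g (d : R) : 0 < d ->
  (forall h, h != 0 -> normc h < d -> f h = g h) ->
  near0_bounded f -> near0_bounded g.
Proof.
move=> d0 fg [M [d' [d'0 fM]]].
exists M, (Num.min d d'); split; first by rewrite lt_min d0.
by move=> h h0; rewrite lt_min => /andP[hd hd']; rewrite -fg // fM.
Qed.

Lemma near0_bounded_eq f g : (forall h, h != 0 -> f h = g h) ->
  near0_bounded f -> near0_bounded g.
Proof. by move=> fg; apply: (@near0_bounded_near f g 1) => // h h0 _; exact: fg. Qed.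

Lemma near0_bounded_scale f a : a != 0 -> near0_bounded f ->
  near0_bounded (fun h => f (a * h)).
Proof.
move=> a0 [M [d [d0 fM]]]; have na0 : 0 < normc a by rewrite normc_gt0.
exists M, (d / normc a); split; first exact: divr_gt0.
move=> h h0; rewrite ltr_pdivlMr // mulrC -normcM => hd.
by apply: fM => //; rewrite mulf_neq0.
Qed.

Lemma near0_bounded_horner p : near0_bounded (horner p).
Proof.
elim/poly_ind: p => [|p c IH].
  apply: (near0_bounded_eq (f := fun=> 0)); last exact: near0_bounded_cst.
  by move=> h _; rewrite horner0.
apply: (near0_bounded_eq (f := fun h => p.[h] * h + c)).
  by move=> h _; rewrite hornerMXaddC.
by apply: near0_boundedD (near0_bounded_cst c); apply: near0_boundedM near0_bounded_id.
Qed.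

Lemma near0_bounded_inv w : w != 0 -> near0_bounded (fun h => (w + h)^-1).
Proof.
move=> w0; have nw0 : 0 < normc w by rewrite normc_gt0.
exists (2 / normc w), (normc w / 2); split=> [|h _ hd]; first by lra.
have hw : normc w / 2 <= normc (w + h) by have := normc_triB w h; lra.
rewrite normcV -[2 / _]invf_div lef_pV2 ?posrE //; lra.
Qed.

(** This is how a constant is computed as a limit: a difference of two constants that is O(h)
    vanishes. *)
Lemma normc_cst_of_bound a : near0_bounded (fun h => a / h) -> a = 0.
Proof.
move=> /near0_bounded_ex[M [d [d0 M0 aM]]]; apply/eqP; rewrite -normc_eq0.
rewrite -[_ == _]negbK; apply/negP => a0.
have na0 : 0 < normc a by rewrite lt_def a0 normc_ge0.
(* At h = t the bound reads |a| <= M t <= |a| / 2. *)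
pose t := Num.min (d / 2) (normc a / (2 * M)).
have t0 : 0 < t by rewrite lt_min !divr_gt0 // mulr_gt0.
have td : t < d by rewrite gt_min; apply/orP; left; lra.
have nt : normc (t%:C) = t by rewrite normc_real gtr0_norm.
have := aM t%:C; rewrite -normc_gt0 nt => /(_ t0 td).
rewrite normcM normcV nt ler_pdivrMr // => aMt.
have : t <= normc a / (2 * M) by rewrite ge_min lexx orbT.
rewrite ler_pdivlMr ?mulr_gt0 //; nra.
Qed.

Lemma expands_near n f g z0 (d : R) : 0 < d ->
  (forall h, normc h < d -> f (z0 + h) = g (z0 + h)) ->
  expands n f z0 -> expands n g z0.
Proof.
move=> d0 fg [p [r [br fE]]].
(* Away from 0 the remainder is solved from the required equation, so that the equation holds for
   every h while only small h are constrained. *)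
exists p, (fun h => if normc h < d then r h else (g (z0 + h) - p.[h]) / h ^+ n).
split.
  by apply: near0_bounded_near d0 _ br => h _ ->.
move=> h; case: ifPn => hd; first by rewrite -fg.
have h0 : h != 0.
  by apply: contraNneq hd => ->; rewrite normc0.
by rewrite divfK ?expf_neq0 //; ring.
Qed.

Lemma expands_eq n f g z0 : f =1 g -> expands n f z0 -> expands n g z0.
Proof. by move=> fg; apply: (expands_near (d := 1)). Qed.

Lemma expands_leq m n f z0 : (m <= n)%N -> expands n f z0 -> expands m f z0.
Proof.
move=> mn [p [r [br fE]]]; exists p, (fun h => r h * h ^+ (n - m)); split.
  by apply: near0_boundedM => //; apply: near0_boundedX near0_bounded_id.
by move=> h; rewrite -mulrA -exprD subnK.
Qed.

Lemma expands_cst n a z0 : expands n (fun=> a) z0.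
Proof.
exists a%:P, (fun=> 0); split; first exact: near0_bounded_cst.
by move=> h; rewrite hornerC mul0r addr0.
Qed.

Lemma expands_id n z0 : expands n id z0.
Proof.
exists ('X + z0%:P), (fun=> 0); split; first exact: near0_bounded_cst.
by move=> h; rewrite !hornerE addrC.
Qed.

Lemma expandsD n f g z0 : expands n f z0 -> expands n g z0 ->
  expands n (fun z => f z + g z) z0.
Proof.
move=> [p [r [br fE]]] [q [s [bs gE]]].
exists (p + q), (fun h => r h + s h); split; first exact: near0_boundedD.
by move=> h; rewrite fE gE hornerD; ring.
Qed.

Lemma expandsM n f g z0 : expands n f z0 -> expands n g z0 ->
  expands n (fun z => f z * g z) z0.
Proof.
move=> [p [r [br fE]]] [q [s [bs gE]]].
exists (p * q), (fun h => p.[h] * s h + r h * (q.[h] + s h * h ^+ n)); split.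
  apply: near0_boundedD; first by apply: near0_boundedM (near0_bounded_horner _) bs.
  apply: near0_boundedM br _; apply: near0_boundedD (near0_bounded_horner _) _.
  by apply: near0_boundedM bs _; apply: near0_boundedX near0_bounded_id.
by move=> h; rewrite fE gE hornerM; ring.
Qed.

Lemma expandsN n f z0 : expands n f z0 -> expands n (fun z => - f z) z0.
Proof.
move=> ef; apply: (expands_eq (f := fun z => (-1) * f z)).
  by move=> z; rewrite mulN1r.
by apply: expandsM ef; exact: expands_cst.
Qed.

Lemma expandsB n f g z0 : expands n f z0 -> expands n g z0 ->
  expands n (fun z => f z - g z) z0.
Proof. by move=> ? ?; apply: expandsD => //; apply: expandsN. Qed.

Lemma expandsX n f z0 m : expands n f z0 -> expands n (fun z => f z ^+ m) z0.
Proof.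
move=> ef; elim: m => [|m IH]; first exact: expands_cst.
by apply: expands_eq (expandsM ef IH) => z; rewrite exprS.
Qed.

Lemma expands_affine n f a w z0 : expands n f (a * z0 + w) ->
  expands n (fun z => f (a * z + w)) z0.
Proof.
have [->|a0] := eqVneq a 0.
  move=> _; apply: expands_eq (expands_cst n (f w) z0) => z.
  by rewrite mul0r add0r.
move=> [p [r [br fE]]].
exists (p \Po (a *: 'X)), (fun h => r (a * h) * a ^+ n); split.
  by apply: near0_boundedM (near0_bounded_cst _); exact: near0_bounded_scale.
move=> h; rewrite horner_comp !hornerE -mulrA -exprMn -fE.
by congr f; ring.
Qed.

Lemma expands_inv n z0 w : z0 != w -> expands n (fun z => (z - w)^-1) z0.
Proof.
have [v vE] : exists v : C, v = z0 - w by exists (z0 - w).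
rewrite -subr_eq0 -vE => v0.
(* A finite geometric sum with its exact remainder. *)
have key h : v + h != 0 ->
  (v + h)^-1 = (\sum_(k < n) (- 1) ^+ k * v ^- k.+1 *: 'X^k).[h]
             + (- 1) ^+ n * v ^- n * (v + h)^-1 * h ^+ n.
  move=> vh; rewrite horner_sum.
  elim: n => [|n IH]; first by rewrite big_ord0 !expr0 invr1 !mul1r mulr1 add0r.
  rewrite big_ord_recr /= {1}IH -[RHS]addrA; congr (_ + _).
  rewrite hornerZ hornerXn !exprS.
  have := expf_neq0 n v0; move: (v ^+ n) ((-1) ^+ n) (h ^+ n) => x y t x0.
  by field; rewrite ?vh ?v0 ?x0.
exists (\sum_(k < n) (- 1) ^+ k * v ^- k.+1 *: 'X^k).
(* At the pole h = - v the geometric formula fails and the remainder is solved from the equation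
   instead; that point is at distance [normc v] from 0. *)
exists (fun h => if v + h == 0
  then (0 - (\sum_(k < n) (- 1) ^+ k * v ^- k.+1 *: 'X^k).[h]) / h ^+ n
  else (- 1) ^+ n * v ^- n * (v + h)^-1); split.
  apply: (@near0_bounded_near (fun h => (- 1) ^+ n * v ^- n * (v + h)^-1) _ (normc v)).
  - by rewrite normc_gt0.
  - move=> h _ hv; case: eqP => // /eqP; rewrite addr_eq0 => /eqP vN.
    by move: hv; rewrite vN normcN ltxx.
  - by apply: near0_boundedM (near0_bounded_inv v0); exact: near0_bounded_cst.
move=> h; rewrite addrAC -vE; case: eqP => [vh|/eqP]; last exact: key.
have h0 : h != 0.
  by move/eqP: vh; rewrite addr_eq0 => /eqP vN; rewrite -oppr_eq0 -vN.
by rewrite vh invr0 divfK ?expf_neq0 //; ring.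
Qed.

Lemma expands_bounded n f z0 : expands n f z0 -> near0_bounded (fun h => f (z0 + h)).
Proof.
move=> [p [r [br fE]]].
apply: (near0_bounded_eq (f := fun h => p.[h] + r h * h ^+ n)) => [h _|].
  by rewrite fE.
apply: near0_boundedD (near0_bounded_horner _) _.
by apply: near0_boundedM br _; apply: near0_boundedX near0_bounded_id.
Qed.

Lemma expands1 f z0 : expands 1 f z0 ->
  exists r, near0_bounded r /\ forall h, f (z0 + h) = f z0 + r h * h.
Proof.
move=> [p [r [br fE]]].
have fz0 : f z0 = p.[0] by rewrite -[z0]addr0 fE expr1 mulr0 addr0.
exists (fun h => (drop_poly 1 p).[h] + r h); split.
  by apply: near0_boundedD br; exact: near0_bounded_horner.
move=> h; rewrite fE fz0 -[p in LHS](poly_take_drop 1) -[p in p.[0]](poly_take_drop 1).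
rewrite !hornerD !hornerM !hornerXn !expr1 mulr0 addr0.
have /size1_polyC -> := size_take_poly 1 p.
by rewrite !hornerC; ring.
Qed.

Lemma expands2 f z0 : expands 2 f z0 ->
  exists b r, near0_bounded r /\ forall h, f (z0 + h) = f z0 + b * h + r h * h ^+ 2.
Proof.
move=> [p [r [br fE]]].
have fz0 : f z0 = p.[0] by rewrite -[z0]addr0 fE expr0n /= mulr0 addr0.
exists p`_1, (fun h => (drop_poly 2 p).[h] + r h); split.
  by apply: near0_boundedD br; exact: near0_bounded_horner.
move=> h; rewrite fE fz0 -{1}[p](poly_take_drop 2) horner_coef0.
rewrite hornerD hornerM hornerXn /take_poly horner_poly big_ord_recr big_ord1 /=.
by rewrite expr0; ring.
Qed.

End LocalExpansions.

(** * The maximum principle on squares *)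

Section MaximumPrinciple.
Variable R : realType.
Local Notation C := R[i].
Implicit Types (F f g : C -> C) (z h : C).

Lemma expands_continuous n F z : (0 < n)%N -> expands n F z ->
  forall e : R, 0 < e -> exists2 d : R, 0 < d &
    forall h, normc h < d -> normc (F (z + h) - F z) < e.
Proof.
move=> n0 /(expands_leq n0)/expands1[r [/near0_bounded_ex[M [d [d0 M0 rM]]] FE]] e e0.
exists (Num.min d (e / M)); first by rewrite lt_min d0 divr_gt0.
move=> h; rewrite lt_min ltr_pdivlMr // => /andP[hd hM].
rewrite FE addrC addrA addNr add0r normcM.
have [->|h0] := eqVneq h 0; first by rewrite normc0 mulr0.
apply: le_lt_trans hM; rewrite mulrC ler_pM2l ?normc_gt0 //; exact: rM.
Qed.

(* The four points z + i^k h kill the terms of degree 1 and 2 of the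
   expansion, so that F is harmonic up to an error O(h^3). *)
Lemma expands3_mean F z j : j ^+ 2 = -1 -> expands 3 F z ->
  exists M d : R, 0 < d /\ forall h, h != 0 -> normc h < d ->
    normc (F (z + h) + F (z - h) + F (z + j * h) + F (z - j * h) - 4 * F z)
      <= M * normc h ^+ 3.
Proof.
move=> i2 [p [r [br FE]]].
have i0 : j != 0.
  by apply/eqP => j0; move/eqP: i2; rewrite j0 expr0n eq_sym oppr_eq0 oner_eq0.
have Fz : F z = p.[0] by rewrite -[z]addr0 FE expr0n mulr0 addr0.
pose q := drop_poly 3 p; pose s h := q.[h] + r h.
have bs : near0_bounded s by apply: near0_boundedD br; exact: near0_bounded_horner.
have {}FE h : F (z + h) = F z + p`_1 * h + p`_2 * h ^+ 2 + s h * h ^+ 3.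
  rewrite FE Fz -{1}[p](poly_take_drop 3) horner_coef0 hornerD hornerM hornerXn.
  rewrite /take_poly horner_poly !big_ord_recr big_ord0 /= /s -/q expr0 expr1.
  by ring.
have bN a : a != 0 -> near0_bounded (fun h => s (a * h)).
  by move=> a0; exact: near0_bounded_scale.
have [M [d [d0 HM]]] : near0_bounded (fun h => s (1 * h) - s ((-1) * h)
    + (- j) * s (j * h) - (- j) * s ((- j) * h)).
  have n1 : (-1 : C) != 0 by rewrite oppr_eq0 oner_eq0.
  have ni : (- j : C) != 0 by rewrite oppr_eq0.
  apply: near0_boundedB; [apply: near0_boundedD; [apply: near0_boundedB|]|].
  - exact/bN/oner_neq0.
  - exact: bN.
  - by apply: near0_boundedM (near0_bounded_cst _) _; exact: bN.
  - by apply: near0_boundedM (near0_bounded_cst _) _; exact: bN.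
exists M, d; split=> // h h0 hd; rewrite -normcX.
have -> : F (z + h) + F (z - h) + F (z + j * h) + F (z - j * h) - 4 * F z =
   (s (1 * h) - s ((-1) * h) + (- j) * s (j * h) - (- j) * s ((- j) * h))
   * h ^+ 3.
  have cubeN (x : C) : (- x) ^+ 3 = - x ^+ 3 by ring.
  have i3 : j ^+ 3 = - j by rewrite exprS i2 mulrN1.
  rewrite (FE h) (FE (- h)) (FE (j * h)) (FE (- (j * h))) mul1r mulN1r [(- j) * h]mulNr.
  by rewrite !sqrrN !cubeN !exprMn i2 i3; ring.
rewrite normcM ler_wpM2r ?normc_ge0 //; exact: HM.
Qed.

(** A square is a product of two segments, which gives its compactness. *)
Definition in_square (r : R) z := `|complex.Re z| <= r /\ `|complex.Im z| <= r.

Lemma normc_square (r : R) z : in_square r z -> normc z <= 2 * r.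
Proof. by move=> [h1 h2]; have := normc_leD z; lra. Qed.

Lemma maximum_square (v : C -> R) (r : R) : 0 <= r ->
  (forall z, in_square r z -> forall e : R, 0 < e -> exists2 d : R, 0 < d &
    forall h, normc h < d -> `|v (z + h) - v z| < e) ->
  exists2 z0, in_square r z0 & forall z, in_square r z -> v z <= v z0.
Proof.
move=> r0 vc.
pose I : set R := [set` `[- r, r]]; pose w (p : R * R) := v (p.1 +i* p.2).
have inI x : I x <-> `|x| <= r.
  by rewrite /I /= in_itv /= ler_norml.
have cI : compact (I `*` I) by apply: compact_setX; exact: segment_compact.
have I0 : (I `*` I) !=set0 by exists (0, 0); split; apply/inI; rewrite normr0.
have cw : {within I `*` I, continuous w}.
  apply: continuous_in_subspaceT => -[x y] /set_mem[/inI /= xr /inI /= yr].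
  apply/cvgrPdist_lt => e e0.
  have [|d d0 vd] := vc (x +i* y) _ e e0; first by split.
  near=> p.
  rewrite distrC /w /=.
  have -> : p.1 +i* p.2 = (x +i* y) + ((p.1 - x) +i* (p.2 - y)).
    by apply/eqP; rewrite eq_complex /= !(addrC x, addrC y) !subrK !eqxx.
  apply: vd; apply: le_lt_trans (normc_leD _) _ => /=.
  rewrite [ltRHS](splitr d); apply: ltrD.
  - near: p; exists (ball x (d / 2), setT) => /=.
      by split; [apply: nbhsx_ballx; rewrite divr_gt0|exact: filterT].
    by move=> [a b] [/= + _]; rewrite /ball /= distrC.
  - near: p; exists (setT, ball y (d / 2)) => /=.
      by split; [exact: filterT|apply: nbhsx_ballx; rewrite divr_gt0].
    by move=> [a b] [/= _]; rewrite /ball /= distrC.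
have [[x y] /set_mem[/inI /= xr /inI /= yr] vmax] := compact_EVT_max I0 cI cw.
exists (x +i* y) => // -[a b] [/= ar br]; apply: (vmax (a, b)).
by apply/mem_set; split; apply/inI.
Unshelve. all: by end_near. Qed.

(** If |F z1| > B, rotate F so that F z1 becomes positive and add eta |z|^2 to the real part. At a
    maximum of this function inside the disc, the four-point sum gains 4 eta t^2 from the added
    term, while the expansion of F costs only O(t^3). The bound B is assumed on the whole square
    outside the disc of radius r, so the maximum is attained inside the disc, where it has room for
    the four points. *)
Lemma maximum_principle F (r B : R) : 0 < r ->
  (forall z, in_square r z -> expands 3 F z) ->
  (forall z, in_square r z -> r <= normc z -> normc (F z) <= B) ->
  forall z, in_square r z -> normc (F z) <= B.
Proof.
move=> r0 eF bF z1 z1r; rewrite leNgt; apply/negP => BF.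
have B0 : 0 <= B.
  apply: le_trans (normc_ge0 (F r%:C)) _; apply: bF.
    by split; rewrite /= ?normr0 ?gtr0_norm // ltW.
  by rewrite normc_real gtr0_norm.
set k := normc (F z1) in BF; have k0 : 0 < k by exact: le_lt_trans B0 BF.
pose u := (F z1)^*%C; have nu : normc u = k.
  by rewrite /u /k; case: (F z1) => a b /=; rewrite sqrrN.
have uF : complex.Re (u * F z1) = k ^+ 2.
  by rewrite /k normc_sqr /u; case: (F z1) => a b /=; ring.
(* On the square eta |z|^2 <= eta (2 r)^2 = k (k - B) / 2, half of the gap between k^2 and k B. *)
pose eta := k * (k - B) / (8 * r ^+ 2).
have eta0 : 0 < eta by rewrite divr_gt0 ?mulr_gt0 ?exprn_gt0 ?subr_gt0.
pose v z := complex.Re (u * F z) + eta * normc z ^+ 2.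
have [z0 z0r vmax] : exists2 z0, in_square r z0 & forall z, in_square r z -> v z <= v z0.
  apply: maximum_square (ltW r0) _ => z zr e e0.
  pose G z := u * F z.
  have /expands_continuous cF := eF z zr.
  have [d1 d10 hF] := cF isT (e / 2 / k) (divr_gt0 (divr_gt0 e0 (ltr0n _ 2)) k0).
  pose m := 2 * normc z + 1.
  have m0 : 0 < m by rewrite /m; have := normc_ge0 z; lra.
  have em0 : 0 < e / 2 / (eta * m).
    by apply: divr_gt0; [exact: divr_gt0|exact: mulr_gt0].
  exists (Num.min d1 (Num.min 1 (e / 2 / (eta * m)))).
    by rewrite !lt_min d10 em0 ltr01.
  move=> h; rewrite !lt_min => /and3P[hd1 h1 hm].
  have -> : v (z + h) - v z = complex.Re (u * (F (z + h) - F z))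
     + eta * (normc (z + h) ^+ 2 - normc z ^+ 2).
    by rewrite /v mulrBr ReD ReN; ring.
  apply: le_lt_trans (ler_normD _ _) _; rewrite [ltRHS](splitr e); apply: ltrD.
    apply: le_lt_trans (normc_Re _) _; rewrite normcM nu mulrC -ltr_pdivlMr //.
    exact: hF.
  have etam : 0 < eta * m by exact: mulr_gt0.
  rewrite normrM (gtr0_norm eta0); move: hm; rewrite ltr_pdivlMr // => hm.
  apply: le_lt_trans hm; rewrite mulrCA ler_pM2l // subr_sqr normrM.
  apply: ler_pM => //.
    rewrite ler_norml; apply/andP; split; last by have := ler_normcD z h; lra.
    by have := normc_triB z h; lra.
  rewrite ger0_norm ?addr_ge0 ?normc_ge0 // /m.
  by have := ler_normcD z h; lra.
have vz1 : k ^+ 2 <= v z0.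
  apply: le_trans (vmax z1 z1r); rewrite /v uF lerDl mulr_ge0 ?sqr_ge0 ?ltW //.
have z0in : normc z0 < r.
  rewrite ltNge; apply/negP => rz0.
  have h1 : complex.Re (u * F z0) <= k * B.
    apply: le_trans (ler_norm _) _; apply: le_trans (normc_Re _) _.
    by rewrite normcM nu ler_pM2l // bF.
  have h2 : eta * normc z0 ^+ 2 <= k * (k - B) / 2.
    apply: (@le_trans _ _ (eta * (2 * r) ^+ 2)).
      rewrite ler_pM2l // ler_pXn2r ?nnegrE ?normc_ge0 ?normc_square //.
      by rewrite mulr_ge0 // ltW.
    by rewrite /eta le_eqVlt; apply/orP; left; apply/eqP; field; rewrite gt_eqF.
  have kB : 0 < k * (k - B) by rewrite mulr_gt0 ?subr_gt0.
  move: vz1; rewrite /v; nra.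
have [M [d [d0 mF]]] := expands3_mean (sqr_i R) (eF z0 z0r).
pose M' := k * (`|M| + 1).
have M'0 : 0 < M' by rewrite mulr_gt0 // ltr_wpDl.
(* Small enough for the mean estimate, for the four points to stay in the disc, and for M' t^3 <= 2
   eta t^2. *)
pose t := Num.min (d / 2) (Num.min (r - normc z0) (2 * eta / M')).
have t0 : 0 < t.
  rewrite /t !lt_min subr_gt0 z0in (divr_gt0 d0) //=.
  by apply: divr_gt0 => //; exact: mulr_gt0.
have td : t < d by rewrite /t gt_min; apply/orP; left; lra.
have tr : t <= r - normc z0 by rewrite /t !ge_min lexx orbT.
have tM : t * M' <= 2 * eta by rewrite -ler_pdivlMr // /t !ge_min lexx !orbT.
have nt : normc t%:C = t by rewrite normc_real gtr0_norm.
have nit : normc ('i * t%:C) = t.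
  by rewrite normcM nt /= expr0n expr1n add0r sqrtr1 mul1r.
have insq w : normc w = t -> in_square r (z0 + w).
  move=> wt; have : normc (z0 + w) <= r by have := ler_normcD z0 w; lra.
  by move=> wr; split; [apply: le_trans (normc_Re _) wr|apply: le_trans (normc_Im _) wr].
have v1 : v (z0 + t%:C) <= v z0 by apply/vmax/insq.
have v2 : v (z0 - t%:C) <= v z0 by apply/vmax/insq; rewrite normcN.
have v3 : v (z0 + 'i * t%:C) <= v z0 by apply/vmax/insq.
have v4 : v (z0 - 'i * t%:C) <= v z0 by apply/vmax/insq; rewrite normcN.
have tC0 : t%:C != 0 by rewrite -normc_gt0 nt.
have := mF t%:C tC0; rewrite nt => /(_ td).
set D := (X in normc X) => HD.
have sumN : normc (z0 + t%:C) ^+ 2 + normc (z0 - t%:C) ^+ 2 + normc (z0 + 'i * t%:C) ^+ 2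
   + normc (z0 - 'i * t%:C) ^+ 2 = 4 * normc z0 ^+ 2 + 4 * t ^+ 2.
  by rewrite !normc_sqr; case: (z0) => a b /=; ring.
have sumF : v (z0 + t%:C) + v (z0 - t%:C) + v (z0 + 'i * t%:C) + v (z0 - 'i * t%:C)
    = 4 * v z0 + complex.Re (u * D) + 4 * eta * t ^+ 2.
  rewrite /v.
  have -> : complex.Re (u * D) = complex.Re (u * F (z0 + t%:C)) + complex.Re (u * F (z0 - t%:C))
     + complex.Re (u * F (z0 + 'i * t%:C)) + complex.Re (u * F (z0 - 'i * t%:C)) - 4 * complex.Re (u * F z0).
    rewrite /D mulrDr !mulrDr !ReD mulrN ReN; congr (_ - _).
    by case: (u) (F z0) => [a b] [a' b'] /=; ring.
  by move: sumN; set n0 := normc z0 ^+ 2; nra.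
have : complex.Re (u * D) + 4 * eta * t ^+ 2 <= 0 by lra.
have : - (M' * t ^+ 3) <= complex.Re (u * D).
  have : `|complex.Re (u * D)| <= M' * t ^+ 3.
    apply: le_trans (normc_Re _) _; rewrite normcM nu /M' -mulrA ler_pM2l //.
    apply: le_trans HD _; rewrite ler_wpM2r ?exprn_ge0 ?ltW //.
    by have := ler_norm M; lra.
  by rewrite ler_norml => /andP[].
have : M' * t ^+ 3 <= 2 * eta * t ^+ 2.
  by rewrite exprS mulrA [M' * t]mulrC ler_wpM2r // exprn_ge0 // ltW.
have : 0 < eta * t ^+ 2 by rewrite mulr_gt0 ?exprn_gt0.
lra.
Qed.

End MaximumPrinciple.

(** * Liouville's theorem with isolated exceptional points *)

Section Liouville.
Variable R : realType.
Local Notation C := R[i].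
Implicit Types (F f g : C -> C) (z h : C) (S : C -> Prop).

Lemma exp_unbounded (x K : R) : 1 < x -> exists n, K < x ^+ n.
Proof.
move=> x1; have bern n : 1 + n%:R * (x - 1) <= x ^+ n.
  elim: n => [|n IH]; first by rewrite mul0r addr0 expr0.
  have n0 : 0 <= n%:R :> R by exact: ler0n.
  rewrite exprS -natr1; apply: le_trans (_ : x * (1 + n%:R * (x - 1)) <= _).
    by have := mulr_ge0 n0 (sqr_ge0 (x - 1)); nra.
  by rewrite ler_pM2l //; lra.
have x10 : 0 < x - 1 by lra.
have [n] : exists n, K / (x - 1) < n%:R.
  by exists (Num.bound `|K / (x - 1)|); apply: le_lt_trans (ler_norm _) _; exact: archi_boundP.
rewrite ltr_pdivrMr // => Kn; exists n; apply: lt_le_trans (bern n); lra.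
Qed.

Lemma isolated_seq (s : seq C) z : z \notin s ->
  exists2 d : R, 0 < d & forall a, a \in s -> d <= normc (a - z).
Proof.
elim: s => [|b s IH]; first by exists 1.
rewrite inE negb_or => /andP[zb /IH[d d0 ds]].
exists (Num.min d (normc (b - z))).
  by rewrite lt_min d0 normc_gt0 subr_eq0 eq_sym.
move=> a; rewrite inE => /orP[/eqP ->|/ds ad]; rewrite ge_min ?lexx ?orbT //.
by rewrite ad.
Qed.

(** The finite set is given by a list, from which a polynomial vanishing on it and a minimal
    distance are read off. *)
Definition locally_finite S :=
  forall r : R, exists s : seq C, forall z, S z -> normc z <= r -> z \in s.

(* Set g = (f - f z1) / (z - z1), which is small far away, and let q vanish at
   the punctures in a large square. Then q^3 g^N expands to order 3 everywhere,
   so the maximum principle bounds it, and N -> oo makes the factor q^3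
   harmless. *)
Lemma liouville f S (M : R) : locally_finite S ->
  (forall z, ~ S z -> expands 3 f z) ->
  (forall z, ~ S z -> normc (f z) <= M) ->
  forall z1 z2, ~ S z1 -> ~ S z2 -> f z1 = f z2.
Proof.
move=> lS ef bf z1 z2 Sz1 Sz2.
have [<-//|z12] := eqVneq z1 z2.
apply/eqP; rewrite eq_sym -subr_eq0 -[_ == _]negbK; apply/negP => f12.
pose g z := (f z - f z1) * (z - z1)^-1.
pose D := normc (g z2).
have D0 : 0 < D by rewrite normc_gt0 mulf_neq0 // invr_eq0 subr_eq0 eq_sym.
have M0 : 0 <= M by apply: le_trans (bf z1 Sz1); exact: normc_ge0.
have gM z (e : R) : ~ S z -> 0 < e -> e <= normc (z - z1) -> normc (g z) <= 2 * M / e.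
  move=> Sz e0 ez; rewrite normcM normcV ler_pM ?normc_ge0 ?invr_ge0 ?normc_ge0 //.
    apply: le_trans (ler_normcD _ _) _; rewrite normcN.
    by have := bf _ Sz; have := bf _ Sz1; lra.
  by rewrite lef_pV2 ?posrE // (lt_le_trans e0).
have [G gG] : exists G : R, 0 <= G /\ forall z, ~ S z -> z != z1 -> normc (g z) <= G.
  have := ef z1 Sz1 => /(expands_leq (isT : (1 <= 3)%N))/expands1[r [br fE]].
  have [G1 [d [d0 G10 rG]]] := near0_bounded_ex br.
  exists (Num.max G1 (2 * M / d)); split; first by rewrite le_max ltW.
  move=> z Sz zz1; rewrite le_max; have [zd|dz] := ltP (normc (z - z1)) d.
    apply/orP; left; rewrite /g.
    have -> : f z = r (z - z1) * (z - z1) + f z1 by rewrite addrC -fE addrC subrK.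
    rewrite addrK mulfK ?subr_eq0 //.
    by apply: rG; rewrite ?subr_eq0.
  by apply/orP; right; exact: gM.
case: gG => G0 gG.
(* Chosen so that outside the disc of radius r the bound [gam] on |g| is at most D / 2; M + 1
   instead of M keeps [gam] positive. *)
pose r := normc z1 + normc z2 + 1 + 4 * (M + 1) / D.
have r0 : 0 < r.
  have := normc_ge0 z1; have := normc_ge0 z2.
  have : 0 < 4 * (M + 1) / D by rewrite divr_gt0 // mulr_gt0 //; lra.
  by rewrite /r; lra.
have rz1 : 4 * (M + 1) / D <= r - normc z1.
  by rewrite /r; have := normc_ge0 z2; lra.
have [s0 s0S] := lS (2 * r + 1).
(* The list may contain points outside S: z2 is removed since q z2 must not vanish, and z1 is added
   since g is singular there. *)
pose s := z1 :: [seq a <- s0 | a != z2].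
have sS z : S z -> normc z <= 2 * r + 1 -> z \in s.
  move=> Sz zr; rewrite inE mem_filter s0S // andbT /=; apply/orP; right.
  by apply: contraPneq Sz => ->.
have sz2 : z2 \notin s by rewrite inE mem_filter /= eqxx /= orbF eq_sym.
pose q z := \prod_(a <- s) (z - a).
have q_eq0 z : (q z == 0) = (z \in s).
  apply/idP/idP.
    move=> /eqP; rewrite /q; elim: (s) => [|b t IH]; rewrite ?big_nil ?big_cons => /eqP.
      by rewrite oner_eq0.
    rewrite mulf_eq0 inE subr_eq0 => /orP[->//|/eqP/IH ->]; exact: orbT.
  by move=> zs; rewrite /q (big_rem z) //= subrr mul0r.
have eq n z : expands n q z.
  rewrite /q; elim: (s) => [|b t IH].
    by apply: expands_eq (expands_cst n 1 z) => x; rewrite big_nil.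
  apply: (expands_eq (f := fun x => (x - b) * \prod_(a <- t) (x - a))).
    by move=> x; rewrite big_cons.
  apply: expandsM => //; apply: expandsB; [exact: expands_id|exact: expands_cst].
have [Q [Q0 qQ]] : exists Q : R, 0 <= Q /\ forall z, normc z <= 2 * r -> normc (q z) <= Q.
  rewrite /q; elim: (s) => [|b t [Q [Q0 qQ]]].
    by exists 1; split => // z _; rewrite big_nil normc1.
  have b0 : 0 <= 2 * r + normc b by have := normc_ge0 b; lra.
  exists ((2 * r + normc b) * Q); split; first exact: mulr_ge0.
  move=> z zr; rewrite big_cons normcM ler_pM ?normc_ge0 ?qQ //.
  by apply: le_trans (ler_normcD _ _) _; rewrite normcN lerD2r.
(* At a point of s the cube makes F equal to h^3 times a bounded function, which is an expansion to
   order 3 with polynomial part 0. *)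
pose F N z := if z \in s then 0 else q z ^+ 3 * g z ^+ N.
have eF N z : in_square r z -> expands 3 (F N) z.
  move=> /normc_square zr; have [zs|zs] := boolP (z \in s).
    have [b [rr [brr qE]]] := expands2 (eq 2%N z).
    have qz : q z = 0 by apply/eqP; rewrite q_eq0.
    pose k h := b + rr h * h.
    have bk : near0_bounded k.
      apply: near0_boundedD (near0_bounded_cst _) _.
      exact: near0_boundedM brr (@near0_bounded_id R).
    have {}qE h : q (z + h) = k h * h by rewrite qE qz /k; ring.
    exists 0, (fun h => F N (z + h) / h ^+ 3); split; last first.
      move=> h; rewrite horner0 add0r.
      have [->|h0] := eqVneq h 0; last by rewrite divfK // expf_neq0.
      by rewrite addr0 /F zs !mul0r.
    have [K [d [d0 K0 kK]]] := near0_bounded_ex bk.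
    exists (K ^+ 3 * G ^+ N), (Num.min d 1); split; first by rewrite lt_min d0 ltr01.
    move=> h h0; rewrite lt_min => /andP[hd h1]; rewrite /F.
    case: ifPn => [_|zhs].
      by rewrite mul0r normc0 mulr_ge0 ?exprn_ge0 // ltW.
    rewrite qE exprMn mulrAC mulfK ?expf_neq0 // normcM !normcX.
    rewrite ler_pM ?exprn_ge0 ?normc_ge0 // lerXn2r ?nnegrE ?normc_ge0 ?kK ?(ltW K0) //.
    apply: gG.
      move=> /sS zS; move/negP: zhs; apply; apply: zS.
      by have := ler_normcD z h; lra.
    by apply: contraNneq zhs => ->; rewrite inE eqxx.
  have [d d0 ds] := isolated_seq zs.
  have Sz : ~ S z by move=> /sS zS; move/negP: zs; apply; apply: zS; lra.
  have zz1 : z != z1 by apply: contraNneq zs => ->; rewrite inE eqxx.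
  apply: (@expands_near _ _ (fun x => q x ^+ 3 * g x ^+ N) _ _ d) => //.
    move=> h hd; rewrite /F; case: ifP => // /ds.
    by rewrite addrAC subrr add0r leNgt hd.
  apply: expandsM; apply: expandsX => //; apply: expandsM; last exact: expands_inv.
  by apply: expandsB; [exact: ef|exact: expands_cst].
pose gam := 2 * (M + 1) / (r - normc z1).
have rz0 : 0 < r - normc z1.
  by apply: lt_le_trans rz1; rewrite divr_gt0 // mulr_gt0 //; lra.
have gam0 : 0 < gam by rewrite divr_gt0 // mulr_gt0 //; lra.
have bF N z : in_square r z -> r <= normc z -> normc (F N z) <= Q ^+ 3 * gam ^+ N.
  move=> /normc_square zr rz; rewrite /F; case: ifPn => zs.
    by rewrite normc0 mulr_ge0 ?exprn_ge0 // ltW.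
  have Sz : ~ S z by move=> /sS zS; move/negP: zs; apply; apply: zS; lra.
  rewrite normcM !normcX ler_pM ?exprn_ge0 ?normc_ge0 //.
    by rewrite lerXn2r ?nnegrE ?normc_ge0 ?qQ.
  rewrite lerXn2r ?nnegrE ?normc_ge0 ?(ltW gam0) //.
  apply: (@le_trans _ _ (2 * M / (r - normc z1))).
    apply: gM => //; have := ler_normcD (z - z1) z1; rewrite subrK; lra.
  by rewrite /gam ler_pM2r ?invr_gt0 //; lra.
have z2r : in_square r z2.
  have z2r : normc z2 <= r.
    have : 0 < 4 * (M + 1) / D by rewrite divr_gt0 // mulr_gt0 //; lra.
    by have := normc_ge0 z1; rewrite /r; lra.
  by split; [apply: le_trans (normc_Re _) z2r|apply: le_trans (normc_Im _) z2r].
have key N : normc (q z2) ^+ 3 * D ^+ N <= Q ^+ 3 * gam ^+ N.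
  have := maximum_principle r0 (eF N) (bF N) z2r.
  by rewrite /F (negbTE sz2) normcM !normcX.
have q20 : 0 < normc (q z2) ^+ 3 by rewrite exprn_gt0 // normc_gt0 q_eq0.
have gD : 2 * gam <= D.
  rewrite /gam mulrA ler_pdivrMr //; move: rz1; rewrite ler_pdivrMr //; lra.
have [N] := exp_unbounded (Q ^+ 3 / normc (q z2) ^+ 3) (ltr1n _ 2 : 1 < (2 : R)).
rewrite ltr_pdivrMr // mulrC => QN.
have g0N : 0 < gam ^+ N by rewrite exprn_gt0.
have : normc (q z2) ^+ 3 * (2 * gam) ^+ N <= Q ^+ 3 * gam ^+ N.
  apply: le_trans (key N); rewrite ler_pM2l // lerXn2r ?nnegrE //; last exact: ltW.
  by rewrite mulr_ge0 // ltW.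
by rewrite exprMn mulrA ler_pM2r // leNgt QN.
Qed.

(** Compactness is used as near-covering, with the bound itself running along the filter at +oo. *)
Lemma locally_bounded_square f (r : R) :
  (forall z, near0_bounded (fun h => f (z + h))) ->
  exists M : R, forall z, in_square r z -> normc (f z) <= M.
Proof.
move=> bf.
pose I : set R := [set` `[- r, r]].
have inI x : I x <-> `|x| <= r by rewrite /I /= in_itv /= ler_norml.
have : compact (I `*` I) by apply: compact_setX; exact: segment_compact.
rewrite compact_near_coveringP.
move=> /(_ R (pinfty_nbhs R) (fun M p => normc (f (p.1 +i* p.2)) <= M) _)[].
  move=> [x y] _; have [M [d [d0 fM]]] := bf (x +i* y).
  (* [near0_bounded] says nothing about the centre, so the bound must also exceed the value
     there. *)
  exists ([set p | ball x (d / 2) p.1 /\ ball y (d / 2) p.2],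
          [set N | M <= N /\ normc (f (x +i* y)) <= N]) => /=.
    split.
      exists (ball x (d / 2), ball y (d / 2)) => //=.
      by split; apply: nbhsx_ballx; rewrite divr_gt0.
    exists (Num.max M (normc (f (x +i* y)))); split; first exact: num_real.
    by move=> N /=; rewrite gt_max => /andP[/ltW -> /ltW ->].
  move=> [[a b] N] /= [[xa yb] [MN fN]].
  have [/eqP|ab] := boolP (a +i* b == x +i* y); first by move=> ->.
  apply: le_trans MN.
  have -> : a +i* b = (x +i* y) + (a +i* b - (x +i* y)) by ring.
  apply: fM; first by rewrite subr_eq0.
  apply: le_lt_trans (normc_leD _) _ => /=.
  move: xa yb; rewrite /ball /= (distrC x a) (distrC y b); lra.
move=> M [_ HM]; exists (M + 1) => -[a b] [/= ar br].
by apply: (HM (M + 1) _ (a, b)); [rewrite ltrDl|split; apply/inI].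
Qed.

Lemma liouville_periodic f S (L : C -> Prop) (r : R) : locally_finite S ->
  (forall z, exists2 l, L l & in_square r (z + l)) ->
  (forall z l, ~ S z -> L l -> f (z + l) = f z) ->
  (forall z, near0_bounded (fun h => f (z + h))) ->
  (forall z, ~ S z -> expands 3 f z) ->
  forall z1 z2, ~ S z1 -> ~ S z2 -> f z1 = f z2.
Proof.
move=> lS cover per /(locally_bounded_square r)[M fM] ef.
apply: (liouville lS ef (M := M)) => z Sz.
by have [l Ll zl] := cover z; rewrite -(per z l Sz Ll); exact: fM.
Qed.

End Liouville.

(** * Unconditional sums *)

Section UnconditionalSums.
Variables (R : realType) (I : choiceType).
Local Notation C := R[i].
Implicit Types (F G : I -> C) (s t : C) (A B : {fset I}).

(** The index is a whole type, with terms 0 off the lattice: translations and multiplications by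
    units then act as bijections of the plane. *)
Definition has_sum F s := forall e : R, 0 < e -> exists A, forall B,
  (A `<=` B)%fset -> normc (\sum_(i <- B) F i - s) < e.

Lemma has_sum_eq F G s : F =1 G -> has_sum F s -> has_sum G s.
Proof.
move=> FG Fs e /Fs[A AB]; exists A => B /AB.
by under eq_bigr do rewrite FG.
Qed.

Lemma has_sum_unique F s t : has_sum F s -> has_sum F t -> s = t.
Proof.
move=> Fs Ft; apply/eqP; rewrite -subr_eq0 -normc_eq0 -[_ == _]negbK.
apply/negP => st; have e0 : 0 < normc (s - t) / 2.
  by rewrite divr_gt0 // lt_def st normc_ge0.
have [A AB] := Fs _ e0; have [A' AB'] := Ft _ e0.
have := AB (A `|` A')%fset (fsubsetUl _ _).
have := AB' (A `|` A')%fset (fsubsetUr _ _).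
set u := \sum_(i <- _) _; rewrite (normc_dist u s).
have := ler_normcD (s - u) (u - t); rewrite addrA subrK; lra.
Qed.

Lemma has_sumD F G s t : has_sum F s -> has_sum G t ->
  has_sum (fun i => F i + G i) (s + t).
Proof.
move=> Fs Gt e e0; have e20 : 0 < e / 2 by rewrite divr_gt0.
have [A AB] := Fs _ e20; have [A' AB'] := Gt _ e20.
exists (A `|` A')%fset => B AA'B.
have := AB B (fsubset_trans (fsubsetUl _ _) AA'B).
have := AB' B (fsubset_trans (fsubsetUr _ _) AA'B).
rewrite big_split /=; set u := \sum_(i <- B) F i; set v := \sum_(i <- B) G i.
have -> : u + v - (s + t) = (u - s) + (v - t) by ring.
have := ler_normcD (u - s) (v - t); lra.
Qed.

Lemma has_sumZ F s c : has_sum F s -> has_sum (fun i => c * F i) (c * s).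
Proof.
move=> Fs e e0; have k0 : 0 < normc c + 1 by have := normc_ge0 c; lra.
have [A AB] := Fs _ (divr_gt0 e0 k0); exists A => B /AB.
rewrite -mulr_sumr -mulrBr normcM ltr_pdivlMr // => h.
apply: le_lt_trans h; rewrite mulrC ler_wpM2l ?normc_ge0 //; lra.
Qed.

Lemma has_sumN F s : has_sum F s -> has_sum (fun i => - F i) (- s).
Proof.
move=> Fs; rewrite -mulN1r; apply: has_sum_eq (has_sumZ (-1) Fs) => i.
exact: mulN1r.
Qed.

Lemma has_sumB F G s t : has_sum F s -> has_sum G t ->
  has_sum (fun i => F i - G i) (s - t).
Proof. by move=> Fs Gt; apply: has_sumD => //; apply: has_sumN. Qed.

Lemma has_sum_point (i0 : I) (c : C) : has_sum (fun i => if i == i0 then c else 0) c.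
Proof.
move=> e e0; exists [fset i0]%fset => B; rewrite fsub1set => i0B.
rewrite (big_fsetD1 i0) //= eqxx big1_fset ?addr0 ?subrr ?normc0 //.
by move=> i; rewrite !inE => /andP[/negbTE ->].
Qed.

Lemma has_sum_reindex F s (f g : I -> I) : cancel f g -> cancel g f ->
  has_sum F s -> has_sum (F \o f) s.
Proof.
move=> fK gK Fs e /Fs[A AB]; exists [fset g x | x in A]%fset => B gAB.
have := AB [fset f x | x in B]%fset.
rewrite big_imfset /=; last by move=> x y _ _; exact: can_inj fK x y.
apply; apply/fsubsetP => x xA; apply/imfsetP; exists (g x) => //=.
by apply: (fsubsetP gAB); apply/imfsetP; exists x.
Qed.

Lemma has_sum_bound F s (M : R) : has_sum F s ->
  (forall A, \sum_(i <- A) normc (F i) <= M) -> normc s <= M.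
Proof.
move=> Fs FM; rewrite leNgt; apply/negP => Ms.
have [A /(_ A (fsubset_refl _))] := Fs (normc s - M) (ltac:(by rewrite subr_gt0)).
have : normc (\sum_(i <- A) F i) <= M.
  apply: le_trans (FM A); elim/big_ind2: _ => //; first by rewrite normc0.
  by move=> x1 x2 y1 y2 h1 h2; apply: le_trans (ler_normcD _ _) _; exact: lerD.
set u := \sum_(i <- A) _.
have := ler_normcD u (s - u); rewrite addrC subrK (normc_dist u s); lra.
Qed.

Lemma has_sum_nonneg (G : I -> R) (M : R) : (forall i, 0 <= G i) ->
  (forall A, \sum_(i <- A) G i <= M) -> exists s : R, has_sum (fun i => (G i)%:C) s%:C.
Proof.
move=> G0 GM; pose X := [set \sum_(i <- A) G i | A in [set: {fset I}]].
have supX : has_sup X.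
  split; first by exists (\sum_(i <- fset0) G i), fset0.
  by exists M => _ [A _ <-].
exists (sup X) => e e0.
have [_ [A _ <-] eA] := sup_adherent e0 supX.
exists A => B AB; rewrite -rmorph_sum -rmorphB normc_real /=.
have AB' : \sum_(i <- A) G i <= \sum_(i <- B) G i.
  rewrite (big_fsetID _ (mem A) B) /=.
  have -> : [fset i in B | i \in A]%fset = A.
    apply/fsetP => i; rewrite !inE andbC; case: (boolP (i \in A)) => //= iA.
    exact: (fsubsetP AB).
  by rewrite lerDl sumr_ge0.
have BX : \sum_(i <- B) G i <= sup X.
  by apply: sup_upper_bound => //; exists B.
by rewrite ler0_norm ?subr_le0 //; lra.
Qed.

Lemma has_sum_dominated F (H : I -> R) (M : R) : (forall i, normc (F i) <= H i) ->
  (forall A, \sum_(i <- A) H i <= M) -> exists2 s, has_sum F s & normc s <= M.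
Proof.
move=> FH HM; have H0 i : 0 <= H i by apply: le_trans (FH i); exact: normc_ge0.
have real_sum (G : I -> R) : (forall i, `|G i| <= H i) ->
    exists s : R, has_sum (fun i => (G i)%:C) s%:C.
  move=> GH; have [||s Hs] := @has_sum_nonneg (fun i => G i + H i) (M + M).
  - by move=> i; have := GH i; rewrite ler_norml => /andP[]; lra.
  - move=> A; rewrite big_split /=; apply: lerD => //.
    apply: le_trans (HM A); apply: ler_sum => i _.
    exact: le_trans (ler_norm _) (GH i).
  have [t Ht] := has_sum_nonneg H0 HM.
  exists (s - t); rewrite rmorphB /=; apply: has_sum_eq (has_sumB Hs Ht) => i.
  by rewrite -rmorphB /= addrK.
have [x Fx] := real_sum (fun i => complex.Re (F i)) (fun i => le_trans (normc_Re _) (FH i)).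
have [y Fy] := real_sum (fun i => complex.Im (F i)) (fun i => le_trans (normc_Im _) (FH i)).
have Fs : has_sum F (x%:C + 'i * y%:C).
  apply: has_sum_eq (has_sumD Fx (has_sumZ 'i Fy)) => i /=.
  by rewrite [RHS]complexE.
exists (x%:C + 'i * y%:C) => //; apply: has_sum_bound Fs _ => A.
by apply: le_trans (HM A); apply: ler_sum.
Qed.

End UnconditionalSums.

Lemma sum_has_sum (R : realType) (D : set R[i]) (F : R[i] -> R[i]) (s : R[i]) :
  (forall x, ~ D x -> F x = 0) -> has_sum F s ->
  sum (fun x : D => F (sval x) : 'CC[R]) = s.
Proof.
move=> F0 Fs; have tF : ProperFilter (@totally D) := totally_filter.
apply: cvg_lim; first exact: norm_hausdorff.
apply/cvgrPdist_lt => e e0.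
have [er erE] : exists er : R, e = er%:C.
  by exists (complex.Re e); rewrite RRe_real // gtr0_real.
have er0 : 0 < er by rewrite -ltcR -erE.
have [A AB] := Fs _ er0.
pose A' : {fset D} := [fset x in pmap insub (enum_fset A)]%fset.
exists A' => //= B AB'.
(* The elements of A that are missing from B lie outside D and contribute 0, so A may be added to
   the index set. *)
have -> : partial_sum (fun x : D => F (sval x) : 'CC[R]) B
    = \sum_(i <- ([fset val x | x in B] `|` A)%fset) F i.
  rewrite /partial_sum (big_fsetID _ (mem [fset val x | x in B]%fset)) /=.
  rewrite [X in _ = _ + X]big1_fset ?addr0; last first.
    move=> x; rewrite !inE => /andP[/orP[-> //|xA] xB] _; apply: F0 => Dx.
    move/negP: xB; apply; apply/imfsetP; exists (exist _ x (mem_set Dx)) => //=.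
    apply: (fsubsetP AB'); rewrite !inE mem_pmap; apply/mapP.
    exists x => //; case: insubP => [y _ yx|]; last by rewrite (mem_set Dx).
    by congr Some; apply: val_inj; rewrite yx.
  have -> : [fset x in [fset val x | x in B] `|` A | x \in [fset val x | x in B]]%fset
    = [fset val x | x in B]%fset.
    by apply/fsetP => x; rewrite !inE; case: (x \in _) => //=; rewrite ?andbF.
  rewrite big_imfset /=; last by move=> x y _ _; exact: val_inj.
  by rewrite big_seq_fsetE.
rewrite distrC erE normrc ltcR; apply: AB; exact: fsubsetUr.
Qed.

(** * Lattices that are rings, and their Weierstrass function *)

Section RingLattice.
Variable R : realType.
Local Notation C := R[i].
Implicit Types (L : set C) (x z h l u : C) (n : nat).

Definition inv_cube L x : R :=
  if `[< L x >] && (x != 0) then normc x ^- 3 else 0.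

(** The common interface of the two lattices. Closure under products is complex multiplication: it
    makes z -> P (a z) periodic under L for every a in L. *)
Record ring_lattice L : Prop := RingLattice {
  lattice_one : L 1;
  latticeB : forall x y, L x -> L y -> L (x - y);
  latticeM : forall x y, L x -> L y -> L (x * y);
  lattice_norm : forall x, L x -> x != 0 -> 1 <= normc x;
  lattice_cover : forall z, exists2 l, L l & in_square 1 (z + l);
  lattice_finite : locally_finite L;
  lattice_summable : exists B : R, forall A : {fset C},
    \sum_(x <- A) inv_cube L x <= B }.

Variables (L : set C) (rL : ring_lattice L).

Lemma lattice0 : L 0.
Proof. by have := latticeB rL (lattice_one rL) (lattice_one rL); rewrite subrr. Qed.

Lemma latticeN x : L x -> L (- x).
Proof. by move=> /(latticeB rL lattice0); rewrite sub0r. Qed.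

Lemma latticeD x y : L x -> L y -> L (x + y).
Proof. by move=> Lx /latticeN /(latticeB rL Lx); rewrite opprK. Qed.

Lemma latticeDl x y : L x -> L (x + y) <-> L y.
Proof.
move=> Lx; split; last exact: latticeD.
by move=> /(latticeB rL) /(_ Lx); rewrite addrC addKr.
Qed.

Lemma lattice_nat n : L n%:R.
Proof.
by elim: n => [|n IH]; [exact: lattice0|rewrite -natr1; apply: latticeD IH (lattice_one rL)].
Qed.

Lemma lattice_small x : normc x < 1 -> x != 0 -> ~ L x.
Proof. by move=> x1 x0 /(lattice_norm rL) /(_ x0); rewrite leNgt x1. Qed.

(** Beyond radius 2 |z| + 1 the constant 1/2 works; only finitely many lattice points remain, at a
    positive distance from z. *)
Lemma lattice_separated z : exists2 c : R, 0 < c <= 1 &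
  forall x, L x -> x != 0 -> x != z -> c * normc x <= normc (z - x).
Proof.
have [s sL] := lattice_finite rL (2 * normc z + 1).
have [|d d0 ds] := @isolated_seq R [seq x <- s | x != z] z.
  by rewrite mem_filter eqxx.
have z0 : 0 < 2 * normc z + 1 by have := normc_ge0 z; lra.
exists (Num.min (1 / 2) (d / (2 * normc z + 1))).
  rewrite lt_min divr_gt0 //= divr_gt0 //= ge_min; apply/orP; left; lra.
move=> x Lx x0 xz; have [xr|rx] := leP (normc x) (2 * normc z + 1).
  apply: (@le_trans _ _ (d / (2 * normc z + 1) * normc x)).
    by rewrite ler_wpM2r ?normc_ge0 // ge_min lexx orbT.
  apply: (@le_trans _ _ d).
    by rewrite mulrAC ler_pdivrMr // ler_pM2l.
  by rewrite normc_dist; apply: ds; rewrite mem_filter xz sL.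
apply: (@le_trans _ _ (1 / 2 * normc x)).
  by rewrite ler_wpM2r ?normc_ge0 // ge_min lexx.
have := normc_triB x (- z); rewrite normcN (normc_dist x z); lra.
Qed.

(** B is fixed before F, so a family of series indexed by h gets a bound uniform in h. *)
Lemma has_sum_inv_cube : exists B : R, forall (F : C -> C) (K : R), 0 <= K ->
  (forall x, normc (F x) <= K * inv_cube L x) ->
  exists2 s, has_sum F s & normc s <= K * B.
Proof.
have [B HB] := lattice_summable rL; exists B => F K K0 FK.
apply: has_sum_dominated FK _ => A; rewrite -mulr_sumr.
by rewrite ler_wpM2l.
Qed.

Definition wp_term z x : C :=
  if `[< L x >] && (x != 0) then 1 / (z - x) ^+ 2 - 1 / x ^+ 2 else 0.

Definition wp_reg z : C :=
  sum (fun l : L `\ 0 => 1 / (z - sval l) ^+ 2 - 1 / sval l ^+ 2 : 'CC[R]).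

Lemma wpE z : wp L z = 1 / z ^+ 2 + wp_reg z.
Proof. by []. Qed.

Lemma inv_exp_le (c t : R) n : 0 < c -> 1 <= t ->
  (c * t) ^- n.+3 <= c ^- n.+3 * t ^- 3.
Proof.
move=> c0 t1; have t0 : 0 < t by lra.
rewrite exprMn invfM ler_pM2l ?invr_gt0 ?exprn_gt0 //.
rewrite lef_pV2 ?posrE ?exprn_gt0 // -[n.+3]addn3 exprD.
by rewrite ler_peMl ?exprn_ge0 ?exprn_ege1 // ltW.
Qed.

Lemma wp_term_dominated z : exists2 K : R, 0 <= K &
  forall x, normc (wp_term z x) <= K * inv_cube L x.
Proof.
have [c /andP[c0 _] cL] := lattice_separated z.
have z0 := normc_ge0 z.
pose K := (2 + normc z) * normc z / c ^+ 2 + normc z.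
have K1 : 0 <= (2 + normc z) * normc z / c ^+ 2.
  by rewrite divr_ge0 ?mulr_ge0 ?sqr_ge0 //; lra.
exists K; first by rewrite addr_ge0.
move=> x; rewrite /wp_term /inv_cube; case: ifP => [/andP[/asboolP Lx x0]|_]; last first.
  by rewrite mulr0 normc0.
have x1 := lattice_norm rL Lx x0.
have nx0 : 0 < normc x by rewrite normc_gt0.
(* If x = z, the term is - 1 / x^2 by the convention 0^-1 = 0; the summand [normc z] of K accounts
   for it. *)
have [xz|xz] := eqVneq x z.
  rewrite -xz subrr expr0n /= mul1r invr0 sub0r normcN normcM normc1 mul1r normcV normcX.
  apply: (@le_trans _ _ (normc z * normc x ^- 3)); last first.
    by rewrite ler_pM2r ?invr_gt0 ?exprn_gt0 // lerDr.
  by rewrite -xz le_eqVlt; apply/orP; left; apply/eqP; field; rewrite gt_eqF.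
have w0 : z - x != 0 by rewrite subr_eq0 eq_sym.
have -> : 1 / (z - x) ^+ 2 - 1 / x ^+ 2 = (2 * x - z) * z * (z - x) ^- 2 * x ^- 2.
  by field; rewrite w0 x0.
apply: (@le_trans _ _ ((2 + normc z) * normc x * normc z * (c * normc x) ^- 2 * normc x ^- 2)).
  rewrite !normcM !normcV !normcX ler_pM2r ?invr_gt0 ?exprn_gt0 //.
  rewrite ler_pM ?invr_ge0 ?mulr_ge0 ?exprn_ge0 ?normc_ge0 //.
    rewrite ler_wpM2r //; apply: le_trans (ler_normcD _ _) _.
    by rewrite normcN normcM normc_nat; nra.
  rewrite lef_pV2 ?posrE ?exprn_gt0 ?mulr_gt0 ?normc_gt0 //.
  rewrite lerXn2r ?nnegrE ?normc_ge0 ?mulr_ge0 ?normc_ge0 ?(ltW c0) //; exact: cL.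
have -> : (2 + normc z) * normc x * normc z * (c * normc x) ^- 2 * normc x ^- 2
   = (2 + normc z) * normc z / c ^+ 2 * normc x ^- 3.
  by field; rewrite !gt_eqF.
by rewrite ler_pM2r ?invr_gt0 ?exprn_gt0 // lerDl.
Qed.

Lemma has_sum_wp_reg z : has_sum (wp_term z) (wp_reg z).
Proof.
have [B HB] := has_sum_inv_cube; have [K K0 HK] := wp_term_dominated z.
have [s Hs _] := HB _ _ K0 HK; suff -> : wp_reg z = s by [].
rewrite -(@sum_has_sum R (L `\ 0) (wp_term z) s) //; last first.
  move=> x Dx; rewrite /wp_term; case: ifP => // /andP[/asboolP Lx x0].
  by case: Dx; split=> //; apply/eqP.
rewrite /wp_reg; apply: (f_equal (@sum _ _ 'CC[R])); apply/funext => -[x /= /set_mem[Lx /eqP x0]].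
by rewrite /wp_term x0 asboolT.
Qed.

Lemma wp_reg0 : wp_reg 0 = 0.
Proof.
apply: has_sum_unique (has_sum_wp_reg 0) _.
move=> e e0; exists fset0 => A _; rewrite subr0 big1 ?normc0 // => x _.
by rewrite /wp_term; case: ifP => // _; rewrite sub0r sqrrN subrr.
Qed.

(* Coefficient of h^n in the remainder of the expansion of 1 / (w + h)^2. *)
Definition inv_sqr_rem n (w h : C) : C :=
  (-1) ^+ n * (n.+1%:R * w + n%:R * h) / (w ^+ n.+1 * (w + h) ^+ 2).

Lemma inv_sqr_remS n (w h : C) : w != 0 -> w + h != 0 ->
  inv_sqr_rem n w h =
  (-1) ^+ n * n.+1%:R / w ^+ n.+2 + h * inv_sqr_rem n.+1 w h.
Proof.
move=> w0 wh0; rewrite /inv_sqr_rem -(natr1 n.+1) -(natr1 n) !exprS.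
have := expf_neq0 n w0.
move: (w ^+ n) ((-1) ^+ n) (n%:R : C) => v e m v0.
by field; rewrite w0 wh0 v0.
Qed.

(** Each term is expanded with its exact remainder, and the remainders are summed: for |h| < c / 2
    they are dominated by one multiple of [inv_cube]. The point 0 is allowed, since [wp_reg] omits
    the term with a pole there. *)
Lemma wp_reg_expands n z0 : ~ (L z0 /\ z0 != 0) -> expands n wp_reg z0.
Proof.
move=> Lz0.
have [c /andP[c0 c1] cL'] := lattice_separated z0.
have cL x : L x -> x != 0 -> c * normc x <= normc (z0 - x).
  move=> Lx x0; apply: cL' => //; apply/eqP => xz; apply: Lz0.
  by rewrite -xz.
have cx x : L x -> x != 0 -> c <= c * normc x.
  by move=> Lx x0; rewrite ler_pMr // (lattice_norm rL).
have w0 x : L x -> x != 0 -> z0 - x != 0.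
  by move=> Lx x0; rewrite -normc_gt0; apply: lt_le_trans (cL _ Lx x0); apply: lt_le_trans (cx _ Lx x0).
have hw x h : normc h < c / 2 -> L x -> x != 0 -> normc h <= normc (z0 - x) / 2.
  by move=> hc Lx x0; have := cL _ Lx x0; have := cx _ Lx x0; lra.
have wh x h : normc h < c / 2 -> L x -> x != 0 -> normc (z0 - x) / 2 <= normc (z0 - x + h).
  by move=> hc Lx x0; have := hw _ _ hc Lx x0; have := normc_triB (z0 - x) h; lra.
have wh0 x h : normc h < c / 2 -> L x -> x != 0 -> z0 - x + h != 0.
  move=> hc Lx x0; rewrite -normc_gt0; apply: lt_le_trans (wh _ _ hc Lx x0).
  by rewrite divr_gt0 // normc_gt0 w0.
have [B HB] := has_sum_inv_cube.
(* The correction - 1 / x^2 does not depend on h and therefore enters at order 0 only. *)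
pose Q n h x := if `[< L x >] && (x != 0)
  then inv_sqr_rem n (z0 - x) h - (n == 0%N)%:R / x ^+ 2 else 0.
pose a n x := if `[< L x >] && (x != 0)
  then (-1) ^+ n * n.+1%:R / (z0 - x) ^+ n.+2 - (n == 0%N)%:R / x ^+ 2 else 0.
have QS m h x : normc h < c / 2 -> Q m h x = a m x + h * Q m.+1 h x.
  move=> hc; rewrite /Q /a; case: ifP => [/andP[/asboolP Lx x0]|_]; last by rewrite mulr0 addr0.
  rewrite inv_sqr_remS ?w0 ?wh0 //= mul0r subr0; ring.
have as_ m : exists s, has_sum (a m) s.
  case: m => [|m].
    exists (wp_reg z0); apply: has_sum_eq (has_sum_wp_reg z0) => x.
    by rewrite /wp_term /a expr0 !mul1r.
  have [||s Hs _] := HB (a m.+1) (m.+2%:R * c ^- m.+3); last by exists s.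
    by rewrite mulr_ge0 ?ler0n ?invr_ge0 ?exprn_ge0 ?(ltW c0).
  move=> x; rewrite /a /inv_cube; case: ifP => [/andP[/asboolP Lx x0]|_]; last first.
    by rewrite mulr0 normc0.
  rewrite /= mul0r subr0 !normcM normcV !normcX normcN normc1 expr1n mul1r normc_nat.
  rewrite -mulrA ler_wpM2l ?ler0n //.
  apply: le_trans (inv_exp_le _ c0 (lattice_norm rL Lx x0)).
  rewrite lef_pV2 ?posrE ?exprn_gt0 ?mulr_gt0 ?normc_gt0 ?w0 //.
  by rewrite lerXn2r ?nnegrE ?normc_ge0 ?mulr_ge0 ?normc_ge0 ?(ltW c0) // cL.
have Qs m : exists2 K : R, 0 <= K & forall h, normc h < c / 2 ->
    exists2 s, has_sum (Q m.+1 h) s & normc s <= K.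
  pose K := 4 * (2 * m.+2%:R) * c ^- m.+3.
  have K0 : 0 <= K by rewrite !mulr_ge0 ?ler0n ?invr_ge0 ?exprn_ge0 ?(ltW c0).
  have bound h : normc h < c / 2 -> forall x, normc (Q m.+1 h x) <= K * inv_cube L x.
    move=> hc x; rewrite /Q /inv_cube; case: ifP => [/andP[/asboolP Lx x0]|_]; last first.
      by rewrite mulr0 normc0.
    rewrite /= mul0r subr0 /inv_sqr_rem.
    rewrite normcM normcM (normcX (-1)) normcN normc1 expr1n mul1r normcV.
    rewrite (normcM ((z0 - x) ^+ _)) (normcX (z0 - x)) normcX.
    set W := normc (z0 - x).
    have W0 : 0 < W by rewrite normc_gt0 w0.
    have h1 : normc (m.+2%:R * (z0 - x) + m.+1%:R * h) <= 2 * m.+2%:R * W.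
      apply: le_trans (ler_normcD _ _) _; rewrite !normcM !normc_nat -/W.
      have := hw _ _ hc Lx x0; rewrite -/W => hW.
      have m0 : 0 <= m.+1%:R :> R by exact: ler0n.
      rewrite -[m.+2%:R]natr1; have := normc_ge0 h; nra.
    have h2 : (W ^+ m.+2 * normc (z0 - x + h) ^+ 2)^-1 <= 4 * W ^- m.+4.
      have -> : 4 * W ^- m.+4 = (W ^+ m.+2 * (W / 2) ^+ 2)^-1.
        rewrite -[in LHS](addn2 m.+2) exprD; have := expf_neq0 m.+2 (lt0r_neq0 W0).
        by move: (W ^+ m.+2) => v v0; field; rewrite v0 (lt0r_neq0 W0).
      have P1 : 0 < W ^+ m.+2 by exact: exprn_gt0.
      have P2 : 0 < normc (z0 - x + h) by rewrite normc_gt0 wh0.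
      have P3 : 0 < W / 2 by exact: divr_gt0.
      rewrite lef_pV2 ?posrE;
        [|exact: mulr_gt0 P1 (exprn_gt0 _ P2)|exact: mulr_gt0 P1 (exprn_gt0 _ P3)].
      rewrite (ler_pM2l P1); apply: lerXn2r; [exact: ltW|exact: ltW|exact: wh].
    apply: (@le_trans _ _ (2 * m.+2%:R * W * (4 * W ^- m.+4))).
      apply: ler_pM => //; first exact: normc_ge0.
      rewrite invr_ge0; exact: mulr_ge0 (exprn_ge0 _ (ltW W0)) (exprn_ge0 _ (normc_ge0 _)).
    have -> : 2 * m.+2%:R * W * (4 * W ^- m.+4) = 4 * (2 * m.+2%:R) * W ^- m.+3.
      rewrite exprS; have := expf_neq0 m.+3 (lt0r_neq0 W0).
      by move: (W ^+ m.+3) (m.+2%:R : R) => v y v0; field; rewrite v0 (lt0r_neq0 W0).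
    rewrite /K -[leRHS]mulrA ler_wpM2l ?mulr_ge0 ?ler0n //.
    apply: le_trans (inv_exp_le _ c0 (lattice_norm rL Lx x0)).
    have P4 : 0 < c * normc x by rewrite mulr_gt0 ?normc_gt0.
    rewrite lef_pV2 ?posrE; [|exact: exprn_gt0|exact: exprn_gt0].
    by apply: lerXn2r; [exact: ltW|exact: ltW|exact: cL].
  exists `|K * B| => // h hc.
  have [s Hs sK] := HB _ _ K0 (bound h hc); exists s => //.
  exact: le_trans sK (ler_norm _).
have E m : exists p : {poly C}, forall h s, normc h < c / 2 -> has_sum (Q m h) s ->
    wp_reg (z0 + h) = p.[h] + s * h ^+ m.
  elim: m => [|m [p IH]].
    exists 0 => h s hc Hs; rewrite horner0 add0r mulr1.
    apply: has_sum_unique (has_sum_wp_reg (z0 + h)) _; apply: has_sum_eq Hs => x.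
    rewrite /Q /wp_term; case: ifP => // /andP[/asboolP Lx x0].
    have := wh0 _ _ hc Lx x0; have := w0 _ Lx x0.
    have -> : z0 + h - x = z0 - x + h by ring.
    rewrite /inv_sqr_rem; move: (z0 - x) => w w_neq0 wh_neq0 /=; field.
    by rewrite x0 w_neq0 wh_neq0.
  have [A HA] := as_ m; exists (p + A *: 'X^m) => h s hc Hs.
  rewrite (IH h (A + h * s) hc).
    by rewrite !hornerE exprS; ring.
  apply: has_sum_eq (has_sumD HA (has_sumZ h Hs)) => x.
  by rewrite -QS.
(* [Qs] bounds remainders of positive order, so one more order is taken to cover n = 0. *)
apply: (@expands_leq R n n.+1) => //.
have [p Hp] := E n.+1; have [K K0 HK] := Qs n.
exists p, (fun h => (wp_reg (z0 + h) - p.[h]) / h ^+ n.+1); split; last first.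
  move=> h; have [->|h0] := eqVneq h 0; last by rewrite divfK ?expf_neq0 //; ring.
  have c20 : normc (0 : C) < c / 2 by rewrite normc0 divr_gt0.
  have [s Hs _] := HK 0 c20; rewrite (Hp 0 s c20 Hs) expr0n /=.
  by rewrite !mulr0 !addr0.
exists K, (c / 2); split; first by rewrite divr_gt0.
move=> h h0 hc; have [s Hs sK] := HK h hc.
by rewrite (Hp h s hc Hs) addrC addKr mulfK // expf_neq0.
Qed.

Lemma wp_expands n z0 : ~ L z0 -> expands n (wp L) z0.
Proof.
move=> Lz0; have z00 : z0 != 0 by apply/eqP => z00; apply: Lz0; rewrite z00; exact: lattice0.
apply: (expands_eq (f := fun z => (z - 0)^-1 ^+ 2 + wp_reg z)).
  by move=> z; rewrite wpE subr0 exprVn mul1r.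
apply: expandsD; last by apply: wp_reg_expands => -[].
by apply: expandsX; exact: expands_inv.
Qed.

(* Since 0^-1 = 0, the term of index 0 is 1 / z^2: the sum ranges over all of L. *)
Lemma has_sum_wp z :
  has_sum (fun x => if `[< L x >] then 1 / (z - x) ^+ 2 - 1 / x ^+ 2 else 0) (wp L z).
Proof.
apply: has_sum_eq (has_sumD (has_sum_point 0 (1 / z ^+ 2)) (has_sum_wp_reg z)) => x.
rewrite /wp_term; have [->|x0] := eqVneq x 0; last by rewrite add0r andbT.
by rewrite andbF addr0 asboolT ?subr0 ?expr0n ?invr0 ?mulr0 ?subr0 //; exact: lattice0.
Qed.

(** Shifting the index by l turns P (z + l) - P z into the sum of 1 / x^2 - 1 / (x + l)^2, in which
    z has disappeared. The involution x -> - x - l exchanges the two terms, so this sum equals its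
    opposite. With 0^-1 = 0 the argument covers z in L too. *)
Lemma wpD z l : L l -> wp L (z + l) = wp L z.
Proof.
move=> Ll; have LD x : `[< L (x + l) >] = `[< L x >].
  by apply/asboolP/asboolP; rewrite addrC => /(latticeDl _ Ll).
have LN x : `[< L (- x) >] = `[< L x >].
  by apply/asboolP/asboolP => /latticeN; rewrite ?opprK.
have := has_sum_reindex (addrK l) (subrK l) (has_sum_wp (z + l)).
move=> /has_sumB /(_ (has_sum_wp z)).
set V := (fun i => _) => Vs.
have VE x : V x = if `[< L x >] then 1 / x ^+ 2 - 1 / (x + l) ^+ 2 else 0.
  rewrite /V /= LD; case: ifP => _; last by rewrite subrr.
  have -> : z + l - (x + l) = z - x by ring.
  by ring.
have rK : involutive (fun x => - x - l).
  by move=> x /=; ring.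
have := has_sum_reindex rK rK Vs => Vs'.
have : has_sum (fun x => - V x) (wp L (z + l) - wp L z).
  apply: has_sum_eq Vs' => x /=; rewrite !VE.
  have -> : `[< L (- x - l) >] = `[< L x >] by rewrite -opprD LN LD.
  have -> : - x - l + l = - x by ring.
  have -> : - x - l = - (x + l) by ring.
  case: ifP => _; last by rewrite oppr0.
  by rewrite !sqrrN; ring.
move=> /(has_sum_unique (has_sumN Vs)) /eqP.
rewrite -subr_eq0 -opprD oppr_eq0 -mulr2n mulrn_eq0 /= subr_eq0 => /eqP //.
Qed.

Lemma wp_unit u z : u != 0 -> L u -> L u^-1 -> wp L (u * z) = wp L z / u ^+ 2.
Proof.
move=> u0 Lu LV.
have := has_sum_reindex (mulKf u0) (mulVKf u0) (has_sum_wp (u * z)) => H.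
apply: has_sum_unique H _; rewrite [_ / _]mulrC.
apply: has_sum_eq (has_sumZ (u ^+ 2)^-1 (has_sum_wp z)) => x /=.
have -> : `[< L (u * x) >] = `[< L x >].
  apply/asboolP/asboolP => [ux|]; last exact: latticeM.
  by rewrite -(mulKf u0 x); exact: latticeM.
case: ifP => _; last by rewrite mulr0.
by rewrite -[u * z - u * x]mulrBr !exprMn !mul1r !invfM mulrBr.
Qed.

Lemma wpN z : wp L (- z) = wp L z.
Proof.
have L1 := latticeN (lattice_one rL).
rewrite -mulN1r wp_unit ?oppr_eq0 ?oner_eq0 ?invrN ?invr1 //.
by rewrite sqrrN expr1n divr1.
Qed.

Lemma wp_reg_unit u z : u != 0 -> L u -> L u^-1 -> wp_reg (u * z) = wp_reg z / u ^+ 2.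
Proof.
move=> u0 Lu LV; have := wp_unit z u0 Lu LV; rewrite !wpE exprMn mulrDl.
by rewrite mul1r invfM -[1 / z ^+ 2 / _]mulrA mul1r [X in X + _]mulrC => /addrI.
Qed.

Lemma locally_finite_affine a b : a != 0 -> locally_finite (fun z => L (a * z + b)).
Proof.
move=> a0 r; have [s sL] := lattice_finite rL (normc a * r + normc b).
exists [seq (x - b) / a | x <- s] => z Lz zr; apply/mapP; exists (a * z + b).
  apply: sL => //; apply: le_trans (ler_normcD _ _) _; rewrite normcM lerD2r.
  by rewrite ler_wpM2l ?normc_ge0.
by rewrite addrK mulrC mulKf.
Qed.

Lemma locally_finiteU (S T : C -> Prop) : locally_finite S -> locally_finite T ->
  locally_finite (fun z => S z \/ T z).
Proof.
move=> lS lT r; have [s sS] := lS r; have [t tT] := lT r.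
exists (s ++ t) => z [Sz|Tz] zr; rewrite mem_cat; first by rewrite sS.
by rewrite tT // orbT.
Qed.

Lemma liouville_lattice f S : locally_finite S ->
  (forall z l, ~ S z -> L l -> f (z + l) = f z) ->
  (forall z, near0_bounded (fun h => f (z + h))) ->
  (forall z, ~ S z -> expands 3 f z) ->
  forall z1 z2, ~ S z1 -> ~ S z2 -> f z1 = f z2.
Proof. by move=> lS; apply: liouville_periodic lS (lattice_cover rL). Qed.

End RingLattice.

(** * The Gaussian and Eisenstein integers as ring lattices *)

Section QuadraticLattice.
Variable R : realType.
Local Notation C := R[i].

Lemma sum_inv_cube_pairs N :
  \sum_(i <- iota 0 N) \sum_(j <- iota 0 N) ((i + j).+1%:R ^- 3 : R) <= 3.
Proof.
(* Telescoping by t^-3 <= 3 (1 / (t (t + 1)) - 1 / ((t + 1) (t + 2))), an equality at t = 1; the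
   outer sum then telescopes through 1 / t - 1 / (t + 1). *)
have inner i n : \sum_(j <- iota 0 n) ((i + j).+1%:R ^- 3 : R) <=
   3 * (((i.+1%:R) * (i.+2%:R))^-1 - ((i + n).+1%:R * (i + n).+2%:R)^-1).
  elim: n => [|n IH]; first by rewrite big_nil addn0 subrr mulr0.
  rewrite -addn1 iotaD big_cat /= big_cons big_nil addr0 add0n.
  apply: le_trans (lerD IH (lexx _)) _; rewrite addn1 addnS.
  have : 1 <= (i + n).+1%:R :> R by rewrite ler1n.
  rewrite -[(i + n).+3%:R]natr1 -[(i + n).+2%:R]natr1.
  move: ((i + n).+1%:R : R) ((i.+1%:R * i.+2%:R)^-1 : R) => t c t1.
  rewrite -subr_ge0.
  have -> : 3 * (c - ((t + 1) * (t + 1 + 1))^-1) - (3 * (c - (t * (t + 1))^-1) + t ^- 3)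
     = (5 * t ^+ 2 - 3 * t - 2) / (t ^+ 3 * (t + 1) * (t + 2)) :> R.
    by field; apply/and3P; split; rewrite gt_eqF //; lra.
  apply: divr_ge0; first by nra.
  by rewrite !mulr_ge0 ?exprn_ge0 //; lra.
have {}inner i n : \sum_(j <- iota 0 n) ((i + j).+1%:R ^- 3 : R) <=
    3 * (i.+1%:R^-1 - i.+2%:R^-1).
  apply: le_trans (inner i n) _; rewrite ler_pM2l //.
  have -> : i.+1%:R^-1 - i.+2%:R^-1 = (i.+1%:R * i.+2%:R)^-1 :> R.
    have : i.+1%:R != 0 :> R by rewrite pnatr_eq0.
    have : i.+2%:R != 0 :> R by rewrite pnatr_eq0.
    rewrite -[i.+2%:R]natr1; move: (i.+1%:R : R) => t t2 t1.
    by field; rewrite t1 t2.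
  by rewrite gerBl invr_ge0 mulr_ge0.
apply: (@le_trans _ _ (\sum_(i <- iota 0 N) 3 * (i.+1%:R^-1 - i.+2%:R^-1 : R))).
  by apply: ler_sum.
have -> : \sum_(i <- iota 0 N) 3 * (i.+1%:R^-1 - i.+2%:R^-1 : R) = 3 * (1 - N.+1%:R^-1).
  elim: N => [|N IH]; first by rewrite big_nil invr1 subrr mulr0.
  by rewrite -addn1 iotaD big_cat /= IH big_cons big_nil addn1 add0n; ring.
have : 0 <= N.+1%:R^-1 :> R by rewrite invr_ge0.
by move: (N.+1%:R^-1 : R) => u u0; lra.
Qed.

Lemma ler_sum_subset (T : eqType) (s t : seq T) (F : T -> R) : uniq s ->
  {subset s <= t} -> (forall x, 0 <= F x) ->
  \sum_(x <- s) F x <= \sum_(x <- t) F x.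
Proof.
move=> + + F0; elim: s t => [|x s IH] t; first by rewrite big_nil sumr_ge0.
move=> /= /andP[xs us] st; have xt : x \in t by apply: st; rewrite inE eqxx.
rewrite big_cons [leRHS](big_rem x) //= lerD2l; apply: IH => // y ys.
have := st y; rewrite inE ys orbT => /(_ isT).
rewrite (perm_mem (perm_to_rem xt)) inE => /orP[/eqP yx|//].
by move/negP: xs; case; rewrite -yx.
Qed.

(** Zero is listed twice, which is harmless in an upper bound and makes the factor 2 in
    [sum_int_range] exact. *)
Definition int_range (b : nat) : seq int :=
  [seq (i%:Z)%R | i <- iota 0 b.+1] ++ [seq (- i%:Z)%R | i <- iota 0 b.+1].

Lemma mem_int_range (b : nat) (m : int) : (`|m| <= b)%N -> m \in int_range b.
Proof.
move=> mb; rewrite mem_cat; case: m mb => n nb; apply/orP; [left|right].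
  by apply/mapP; exists n => //; rewrite mem_iota.
by apply/mapP; exists n.+1; rewrite ?mem_iota // NegzE.
Qed.

Lemma sum_int_range (b : nat) (F : nat -> R) :
  \sum_(m <- int_range b) F `|m|%N = 2 * \sum_(i <- iota 0 b.+1) F i.
Proof.
rewrite big_cat !big_map /=; under [X in _ + X]eq_bigr do rewrite abszN.
by rewrite mulr2n mulrDl !mul1r.
Qed.

(** k = true gives the Eisenstein integers, k = false the Gaussian ones: tau is a root of X^2 + k X
    + 1. *)
Variables (k : bool) (tau : C).
Hypotheses (reT : complex.Re tau = - k%:R / 2)
           (imT : complex.Im tau ^+ 2 = 1 - k%:R / 4).

Let kk : (k%:R : R) = 0 \/ (k%:R : R) = 1.
Proof. by case: (k); [right|left]. Qed.

Let pt (m n : int) : C := m%:~R * 1 + n%:~R * tau.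

Lemma pt_Re m n : complex.Re (pt m n) = m%:~R - k%:R * n%:~R / 2.
Proof.
rewrite /pt -!(rmorph_int (real_complex R)) mulr1 ReD.
by move: reT; case: (tau) => a b /= ->; ring.
Qed.

Lemma pt_Im m n : complex.Im (pt m n) = n%:~R * complex.Im tau.
Proof.
rewrite /pt -!(rmorph_int (real_complex R)) mulr1 ImD.
by case: (tau) => a b /=; ring.
Qed.

(** Being an integer, the squared modulus is at least 1 at nonzero points. *)
Lemma pt_norm m n : normc (pt m n) ^+ 2 = (m * m - k%:R * m * n + n * n)%:~R.
Proof.
rewrite normc_sqr pt_Re pt_Im exprMn imT.
rewrite !(rmorphB, rmorphD, rmorphM) /= rmorph_nat.
by case: kk => ->; field.
Qed.

Lemma pt_norm_ge m n : ((m%:~R : R) ^+ 2 + n%:~R ^+ 2) / 2 <= normc (pt m n) ^+ 2.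
Proof.
rewrite normc_sqr pt_Re pt_Im exprMn imT; set x := m%:~R; set y := n%:~R.
have := sqr_ge0 x; have := sqr_ge0 y; have := sqr_ge0 (x - y).
by case: kk => ->; nra.
Qed.

Lemma tau_sqr : tau ^+ 2 = - 1 - k%:R * tau.
Proof.
have -> : (k%:R : C) = (k%:R : R)%:C by rewrite rmorph_nat.
apply/eqP; rewrite eq_complex; move: reT imT; case: (tau) => a b /= -> b2.
apply/andP; split; apply/eqP.
  have -> : - k%:R / 2 * (- k%:R / 2) - b * b = (- k%:R / 2) ^+ 2 - b ^+ 2 :> R by ring.
  by rewrite b2; case: kk => ->; field.
by case: kk => ->; field.
Qed.

Lemma abs_int (m : int) : `|(m%:~R : R)| = `|m|%N%:R.
Proof. by rewrite -intr_norm -natr_absz. Qed.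

Lemma ring_lattice_quadratic : ring_lattice (lattice 1 (tau : 'CC[R])).
Proof.
have inL m n : lattice 1 (tau : 'CC[R]) (pt m n) by exists m => //; exists n.
have Lpt x : lattice 1 (tau : 'CC[R]) x -> exists m n, x = pt m n.
  by move=> [m _ [n _ <-]]; exists m, n.
have bnd (r : R) : exists b : nat, forall m n, normc (pt m n) <= r ->
    (`|m| <= b)%N /\ (`|n| <= b)%N.
  have [b b2'] : exists b : nat, `|2 * r| < b%:R.
    by exists (Num.bound `|2 * r|); exact: archi_boundP.
  exists b => m n mnr.
  have r0 : 0 <= r by apply: le_trans mnr; exact: normc_ge0.
  have b2 : 2 * r < b%:R by exact: le_lt_trans (ler_norm _) b2'.
  have hN : normc (pt m n) ^+ 2 <= r ^+ 2.
    by rewrite lerXn2r ?nnegrE ?normc_ge0.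
  have := pt_norm_ge m n.
  have aux (x y : int) : (x%:~R : R) ^+ 2 + y%:~R ^+ 2 <= 2 * r ^+ 2 -> (`|x| <= b)%N.
    move=> h; rewrite -(ler_nat R) -abs_int; apply: le_trans (ltW b2).
    rewrite -(ler_pXn2r (ltn0Sn 1)) ?nnegrE ?mulr_ge0 // real_normK ?num_real //.
    by have := sqr_ge0 (y%:~R : R); have := sqr_ge0 r; nra.
  by move=> h; split; [apply: (aux m n)|apply: (aux n m)]; lra.
split.
- by exists 1 => //; exists 0 => //; rewrite mul0r addr0 mulr1.
- move=> _ _ /Lpt[m [n ->]] /Lpt[m' [n' ->]].
  suff -> : pt m n - pt m' n' = pt (m - m') (n - n') by [].
  by rewrite /pt !rmorphB /=; ring.
- move=> _ _ /Lpt[m [n ->]] /Lpt[m' [n' ->]].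
  suff -> : pt m n * pt m' n' = pt (m * m' - n * n') (m * n' + n * m' - k%:R * n * n') by [].
  rewrite /pt !(rmorphB, rmorphD, rmorphM) /= rmorph_nat.
  transitivity (m%:~R * m'%:~R + (m%:~R * n'%:~R + n%:~R * m'%:~R) * tau + n%:~R * n'%:~R * tau ^+ 2).
    by ring.
  by rewrite tau_sqr; ring.
- move=> _ /Lpt[m [n ->]]; rewrite -normc_gt0 => x0.
  have := exprn_gt0 2 x0; rewrite pt_norm ltr0z gtz0_ge1 -(ler1z R) -pt_norm.
  by rewrite -[X in X <= _](expr1n _ 2) ler_pXn2r ?nnegrE ?normc_ge0.
- move=> z; have s1 : `|complex.Im tau| <= 1.
    rewrite -(ler_pXn2r (ltn0Sn 1)) ?nnegrE // real_normK ?num_real // imT expr1n.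
    by case: kk => ->; lra.
  have s0 : complex.Im tau != 0.
    apply/eqP => t0; move: imT; rewrite t0 expr0n /=; case: kk => ->; lra.
  have fl (t : R) : `|t + (- Num.floor t)%:~R| <= 1.
    rewrite rmorphN /=; have /andP[h1] := floor_itv t.
    rewrite rmorphD /= => h2.
    by rewrite ger0_norm ?subr_ge0 //; lra.
  (* n settles the imaginary part; m then corrects the real part, already shifted by - k n / 2. *)
  pose n := - Num.floor (complex.Im z / complex.Im tau).
  pose m := - Num.floor (complex.Re z - k%:R * n%:~R / 2).
  exists (pt m n) => //; split.
    rewrite ReD pt_Re; have := fl (complex.Re z - k%:R * n%:~R / 2); rewrite -/m.
    by congr (`| _ | <= 1); ring.
  rewrite ImD pt_Im; have -> : complex.Im z + n%:~R * complex.Im tau =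
      (complex.Im z / complex.Im tau + n%:~R) * complex.Im tau by field.
  by rewrite normrM mulr_ile1 // fl.
- move=> r; have [b Hb] := bnd r.
  exists [seq pt m n | m <- int_range b, n <- int_range b] => _ /Lpt[m [n ->]] /Hb[mb nb].
  by apply/allpairsP; exists (m, n); split => //=; exact: mem_int_range.
(* 64 = 4^3 comes from |pt m n| >= (|m| + |n| + 1) / 4 off 0, each 2 from the signs of m and n, and
   3 from [sum_inv_cube_pairs]. *)
exists (64 * (2 * (2 * 3))) => A.
have [r Hr] : exists r : R, forall x, x \in enum_fset A -> normc x <= r.
  elim: (enum_fset A) => [|x s [r Hr]]; first by exists 0.
  exists (Num.max (normc x) r) => y; rewrite inE => /orP[/eqP ->|/Hr yr].
    by rewrite le_max lexx.
  by rewrite le_max yr orbT.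
have [b Hb] := bnd r.
pose t := [seq pt m n | m <- int_range b, n <- int_range b].
pose iL := inv_cube (lattice 1 (tau : 'CC[R])).
have iL0 x : 0 <= iL x.
  by rewrite /iL /inv_cube; case: ifP => // _; rewrite invr_ge0 exprn_ge0 ?normc_ge0.
apply: (@le_trans _ _ (\sum_(x <- t) iL x)).
  have -> : \sum_(x <- A) iL x = \sum_(x <- [seq x <- A | iL x != 0]) iL x.
    rewrite big_filter [RHS]big_mkcond; apply: eq_bigr => x _.
    by case: eqP.
  apply: ler_sum_subset => //; first by rewrite filter_uniq ?fset_uniq.
  move=> x; rewrite mem_filter => /andP[xL xA].
  move: xL; rewrite /iL /inv_cube; case: ifP; last by rewrite eqxx.
  move=> /andP[/asboolP /Lpt[m [n xE]] _] _.
  have := Hr x xA; rewrite xE => /Hb[mb nb].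
  by apply/allpairsP; exists (m, n); split => //=; exact: mem_int_range.
have bound m n : iL (pt m n) <= 64 * (`|m| + `|n|).+1%:R ^- 3.
  have m0 := normr_ge0 (m%:~R : R); have n0 := normr_ge0 (n%:~R : R).
  rewrite /iL /inv_cube; case: ifP => [/andP[_ x0]|_]; last first.
    by rewrite mulr_ge0 // invr_ge0.
  have := x0; rewrite -normc_gt0 => nx0.
  rewrite -[(_ + _).+1%:R]natr1 natrD -!abs_int.
  set M := `|m%:~R|; set N := `|n%:~R|.
  have MN0 : 0 < M + N + 1 by rewrite ltr_wpDl // addr_ge0.
  have -> : 64 * (M + N + 1) ^- 3 = ((M + N + 1) / 4) ^- 3.
    by field; rewrite gt_eqF.
  have MN4 : 0 < (M + N + 1) / 4 by rewrite divr_gt0.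
  rewrite lef_pV2 ?posrE ?exprn_gt0 // lerXn2r ?nnegrE ?normc_ge0 ?(ltW MN4) //.
  have MN1 : 1 <= M + N.
    have [m_eq0|mn0] := eqVneq m 0.
      have [n_eq0|nn0] := eqVneq n 0.
        by move: x0; rewrite m_eq0 n_eq0 /pt !mul0r addr0 eqxx.
      have : 1 <= N by rewrite /N abs_int ler1n absz_gt0.
      by rewrite /M /N in m0 n0 *; lra.
    have : 1 <= M by rewrite /M abs_int ler1n absz_gt0.
    by rewrite /M /N in m0 n0 *; lra.
  have h1 : ((M + N) / 2) ^+ 2 <= normc (pt m n) ^+ 2.
    apply: le_trans (pt_norm_ge m n); rewrite -(real_normK (num_real (m%:~R : R))).
    rewrite -(real_normK (num_real (n%:~R : R))) -/M -/N.
    by have := sqr_ge0 (M - N); nra.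
  have : (M + N) / 2 <= normc (pt m n).
    by rewrite -(ler_pXn2r (ltn0Sn 1)) ?nnegrE ?normc_ge0 ?divr_ge0 ?addr_ge0.
  lra.
rewrite /t big_flatten big_map; under eq_bigr do rewrite big_map.
apply: (@le_trans _ _ (\sum_(m <- int_range b) \sum_(n <- int_range b)
    64 * (`|m| + `|n|).+1%:R ^- 3)).
  by apply: ler_sum => m _; apply: ler_sum.
under eq_bigr => m _.
  rewrite -mulr_sumr (sum_int_range b (fun j => (`|m| + j).+1%:R ^- 3)).
  over.
rewrite -mulr_sumr ler_pM2l // -mulr_sumr ler_pM2l //.
rewrite (sum_int_range b (fun i => \sum_(j <- iota 0 b.+1) (i + j).+1%:R ^- 3)).
by rewrite ler_pM2l //; exact: sum_inv_cube_pairs.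
Qed.

End QuadraticLattice.

(** This tactic and the next follow the shape of the expression down to leaves found among the
    hypotheses. *)
Ltac near0_bnd := repeat lazymatch goal with
    | |- near0_bounded (fun _ => ?c) => exact: near0_bounded_cst
    | |- near0_bounded (fun h => h) => exact: near0_bounded_id
    | |- near0_bounded (fun h => @?A h + @?B h) => apply: (@near0_boundedD _ A B)
    | |- near0_bounded (fun h => - @?A h) => apply: (@near0_boundedN _ A)
    | |- near0_bounded (fun h => @?A h * @?B h) => apply: (@near0_boundedM _ A B)
    | |- near0_bounded (fun h => @?A h ^+ ?n) => apply: (@near0_boundedX _ A n)
    | |- near0_bounded _ => assumption
    end.

Ltac expnd := repeat lazymatch goal with
    | |- expands _ (fun _ => ?c) _ => exact: expands_cst
    | |- expands _ (fun h => h) _ => exact: expands_id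
    | |- expands _ (fun h => @?A h + @?B h) _ => apply: (@expandsD _ _ A B)
    | |- expands _ (fun h => - @?A h) _ => apply: (@expandsN _ _ A)
    | |- expands _ (fun h => @?A h * @?B h) _ => apply: (@expandsM _ _ A B)
    | |- expands _ (fun h => @?A h ^+ ?n) _ => apply: (@expandsX _ _ A _ n)
    | |- expands _ _ _ => assumption
    end.

(** * Behaviour of P at its pole 0 and at its zeros *)

Section WeierstrassLocal.
Variable R : realType.
Local Notation C := R[i].
Implicit Types (z h u : C).
Variables (L : set C) (rL : ring_lattice L).
Local Notation P := (wp L).
Local Notation phi := (wp_reg L).

Lemma wp_pole h : h != 0 -> P h = h ^- 2 + phi h.
Proof. by move=> h0; rewrite wpE mul1r. Qed.

Lemma wp_reg_bounded : near0_bounded phi.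
Proof.
have /expands_bounded : expands 1 phi 0 by apply: wp_reg_expands => // -[_]; rewrite eqxx.
by apply: near0_bounded_eq => h _; rewrite add0r.
Qed.

Lemma wp_bounded z : ~ L z -> near0_bounded (fun h => P (z + h)).
Proof. by move=> /(wp_expands rL 1)/expands_bounded. Qed.

Lemma wp_scale_expands n a z : ~ L (a * z) -> expands n (fun z => P (a * z)) z.
Proof.
move=> Lz; apply: (expands_eq (f := fun z => P (a * z + 0))).
  by move=> x; rewrite addr0.
by apply: expands_affine; rewrite addr0; exact: wp_expands.
Qed.

Lemma wp_shift_expands n b z : ~ L (z + b) -> expands n (fun z => P (z + b)) z.
Proof.
move=> Lz; apply: (expands_eq (f := fun z => P (1 * z + b))).
  by move=> x; rewrite mul1r.
by apply: expands_affine; rewrite mul1r; exact: wp_expands.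
Qed.

Lemma lattice_half : ~ L (1 / 2).
Proof.
apply: (lattice_small rL); last by rewrite mul1r invr_eq0 pnatr_eq0.
by rewrite mul1r normcV normc_nat; lra.
Qed.

Lemma locally_finite_scale a : a != 0 -> locally_finite (fun z => L (a * z)).
Proof.
move=> a0 r; have [s Hs] := locally_finite_affine rL 0 a0 r.
by exists s => z Lz; apply: Hs; rewrite addr0.
Qed.

Lemma locally_finite_shift b : locally_finite (fun z => L (z + b)).
Proof.
move=> r; have [s Hs] := locally_finite_affine rL b (oner_neq0 C) r.
by exists s => z Lz; apply: Hs; rewrite mul1r.
Qed.

(** Averaging the expansion over h and - h cancels the odd terms. The symmetries of the two lattices
    are exploited below by the same averaging. *)
Lemma wp_reg_even6 : exists c2 c4 r, near0_bounded r /\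
  forall h, phi h = c2 * h ^+ 2 + c4 * h ^+ 4 + r h * h ^+ 6.
Proof.
have [p [r [br phiE]]] : expands 6 phi 0.
  by apply: wp_reg_expands => // -[_]; rewrite eqxx.
pose s h := (drop_poly 6 p).[h] + r h.
have bs : near0_bounded s by apply: near0_boundedD br; exact: near0_bounded_horner.
have {}phiE h : phi h = p`_0 + p`_1 * h + p`_2 * h ^+ 2 + p`_3 * h ^+ 3
    + p`_4 * h ^+ 4 + p`_5 * h ^+ 5 + s h * h ^+ 6.
  rewrite -[h in LHS]add0r phiE -{1}[p](poly_take_drop 6) hornerD hornerM hornerXn.
  rewrite /take_poly horner_poly !big_ord_recr big_ord0 /= /s expr0 expr1.
  by ring.
have p0 : p`_0 = 0.
  by have := phiE 0; rewrite (wp_reg0 rL) !expr0n /= !mulr0 !addr0.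
have n10 : (-1 : C) != 0 by rewrite oppr_eq0 oner_eq0.
have phiN h : phi (- h) = phi h.
  have L1 := latticeN rL (lattice_one rL).
  by rewrite -mulN1r (wp_reg_unit rL) ?invrN ?invr1 // sqrrN expr1n divr1.
exists p`_2, p`_4, (fun h => (s h + s ((-1) * h)) / 2); split.
  by have := near0_bounded_scale n10 bs => bsN; near0_bnd.
move=> h; have -> : phi h = (phi h + phi (- h)) / 2 by rewrite phiN; field.
by rewrite !phiE p0 mulN1r; field.
Qed.

(** A zero h of P would give h^2 phi h = - 1, while phi is bounded near 0. *)
Lemma wp_near0_neq0 : exists2 d : R, 0 < d &
  forall h, h != 0 -> normc h < d -> P h != 0.
Proof.
have [M [d [d0 M0 HM]]] := near0_bounded_ex wp_reg_bounded.
have dM0 : 0 < (M + 1)^-1 by rewrite invr_gt0; lra.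
exists (Num.min (Num.min d 1) (M + 1)^-1); first by rewrite !lt_min d0 ltr01.
move=> h h0; rewrite !lt_min -andbA => /and3P[hd h1 hM].
rewrite wp_pole //; apply/eqP => e0.
have : h ^+ 2 * phi h = -1.
  have -> : phi h = - h ^- 2 by apply/eqP; rewrite -addr_eq0 addrC e0.
  by rewrite mulrN divff // expf_neq0.
move=> /(congr1 (@normc R)); rewrite normcN normc1 normcM normcX => e1.
have nh0 : 0 < normc h by rewrite normc_gt0.
have h2 : normc h ^+ 2 <= normc h by rewrite expr2 ler_piMr ?ltW.
have : normc h ^+ 2 * normc (phi h) <= normc h * M.
  by rewrite ler_pM ?exprn_ge0 ?normc_ge0 ?HM.
have : normc h * (M + 1) < 1 by rewrite -ltr_pdivlMr ?mul1r //; lra.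
rewrite e1; nra.
Qed.

(* Otherwise wp would vanish along z, z / a, z / a^2, ..., which converges to
   the pole 0. *)
Lemma wp_neq0_of_scale a : L a -> 1 < normc a ->
  (forall z, ~ L (a * z) -> P (a * z) = 0 -> P z = 0) ->
  forall z, ~ L z -> P z != 0.
Proof.
move=> La a1 Pa z Lz; apply/eqP => Pz0.
have a0 : a != 0 by rewrite -normc_gt0; lra.
have z0 : z != 0 by apply/eqP => z0; apply: Lz; rewrite z0; exact: lattice0.
have H n : ~ L (z / a ^+ n) /\ P (z / a ^+ n) = 0.
  elim: n => [|n [Ln Pn]]; first by rewrite expr0 divr1.
  have aE : a * (z / a ^+ n.+1) = z / a ^+ n.
    by rewrite exprS; field; rewrite a0 expf_neq0.
  split; first by move=> /(latticeM rL La); rewrite aE.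
  by apply: Pa; rewrite aE.
have [d d0 Hd] := wp_near0_neq0.
have [n Hn] := exp_unbounded (normc z / d) a1.
have [_ /eqP] := H n; apply/negP; apply: Hd.
  by rewrite mulf_neq0 // invr_eq0 expf_neq0.
rewrite normcM normcV normcX ltr_pdivrMr ?exprn_gt0 ?normc_gt0 //.
by move: Hn; rewrite ltr_pdivrMr // mulrC.
Qed.

Lemma wp_simple_zero z : ~ L z -> P z = 0 ->
  exists2 k, near0_bounded k & forall h, P (z + h) = k h * h.
Proof.
move=> Lz Pz; have [k [bk kE]] := expands1 (wp_expands rL 1 Lz).
by exists k => // h; rewrite kE Pz add0r.
Qed.

(** As 2 z is a period, P is even about z, and the linear term of its expansion drops out. *)
Lemma wp_double_zero z : ~ L z -> L (2 * z) -> P z = 0 ->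
  exists2 k, near0_bounded k & forall h, P (z + h) = k h * h ^+ 2.
Proof.
move=> Lz L2z Pz; have [b [r [br rE]]] := expands2 (wp_expands rL 2 Lz).
have even h : P (z - h) = P (z + h).
  rewrite -(wpN rL (z - h)) -(wpD rL _ L2z).
  by congr wp; ring.
have n10 : (-1 : C) != 0 by rewrite oppr_eq0 oner_eq0.
exists (fun h => (r h + r ((-1) * h)) / 2).
  by have := near0_bounded_scale n10 br => brN; near0_bnd.
move=> h; have -> : P (z + h) = (P (z + h) + P (z - h)) / 2 by rewrite even; field.
by rewrite !rE Pz mulN1r; field.
Qed.

End WeierstrassLocal.

(** * The Eisenstein integers: multiplication by 1 + 2 omega *)

Section EisensteinLattice.
Variable R : realType.
Local Notation C := R[i].
Variables (L : set C) (rL : ring_lattice L) (w : C).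
Hypotheses (Lw : L w) (w2 : w ^+ 2 = - 1 - w).
Local Notation P := (wp L).
Local Notation phi := (wp_reg L).
Let a := 1 + 2 * w.

Let a2 : a ^+ 2 = - 3.
Proof.
have -> : a ^+ 2 = 1 + 4 * w + 4 * w ^+ 2 by rewrite /a; ring.
by rewrite w2; ring.
Qed.

Let w3 : w ^+ 3 = 1.
Proof. by rewrite exprS w2 mulrBr mulrN1 -expr2 w2; ring. Qed.

Let w0 : w != 0.
Proof. by apply/eqP => w0; move/eqP: w3; rewrite w0 expr0n eq_sym oner_eq0. Qed.

Let wV : w^-1 = w ^+ 2.
Proof. by apply: (mulfI w0); rewrite divff // -exprS w3. Qed.

Let LwV : L w^-1.
Proof. by rewrite wV expr2; apply: latticeM. Qed.

Let La : L a.
Proof. by apply: latticeD (lattice_one rL) _ => //; apply: latticeM => //; exact: lattice_nat. Qed.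

Let a0 : a != 0.
Proof. by apply/eqP => a0; move/eqP: a2; rewrite a0 expr0n eq_sym oppr_eq0 pnatr_eq0. Qed.

Lemma wp_eisenstein z : P (w * z) = w * P z.
Proof.
rewrite (wp_unit rL) // mulrC; congr (_ * _).
by apply: (mulfI (expf_neq0 2 w0)); rewrite divff ?expf_neq0 // -exprSr w3.
Qed.

(** From phi (w h) = w phi h, averaging over the three rotations keeps the exponents congruent to 1
    modulo 3; 1 + w + w^2 = 0 kills the term in h^2. *)
Lemma wp_reg_eisenstein : exists2 r, near0_bounded r & forall h, phi h = r h * h ^+ 4.
Proof.
have phiw h : phi (w * h) = w * phi h.
  rewrite (wp_reg_unit rL) // mulrC; congr (_ * _).
  by apply: (mulfI (expf_neq0 2 w0)); rewrite divff ?expf_neq0 // -exprSr w3.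
have [c2 [c4 [r [br rE]]]] := wp_reg_even6 rL.
have b1 := near0_bounded_scale w0 br.
have b2 := near0_bounded_scale (expf_neq0 2 w0) br.
exists (fun h => c4 + (r h + w ^+ 2 * r (w * h) + w * r (w ^+ 2 * h)) / 3 * h ^+ 2).
  by near0_bnd.
move=> h.
have e1 : phi h = w ^+ 2 * phi (w * h) by rewrite phiw mulrA -exprSr w3 mul1r.
have e2 : phi h = w * phi (w ^+ 2 * h).
  by rewrite expr2 -[w * w * h]mulrA !phiw -[LHS]mul1r -w3; ring.
have -> : phi h = (phi h + w ^+ 2 * phi (w * h) + w * phi (w ^+ 2 * h)) / 3.
  by rewrite -e1 -e2; field.
rewrite !rE.
have w4 : w ^+ 4 = w by rewrite exprS w3 mulr1.
have w6 : w ^+ 6 = 1 by rewrite -[6%N]/(3 * 2)%N exprM w3 expr1n.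
have w8 : (w ^+ 2) ^+ 4 = w ^+ 2 by rewrite -exprM -[(2 * 4)%N]/(6 + 2)%N exprD w6 mul1r.
have w12 : (w ^+ 2) ^+ 6 = 1 by rewrite -exprM mulnC exprM w6 expr1n.
have w44 : (w ^+ 2) ^+ 2 = w by rewrite -exprM w4.
rewrite ![(w * h) ^+ _]exprMn ![(w ^+ 2 * h) ^+ _]exprMn w4 w6 w8 w12 w44.
transitivity ((c2 * h ^+ 2 * (1 + w ^+ 4 + w ^+ 2) + c4 * h ^+ 4 * (1 + 2 * w ^+ 3)
   + (r h + w ^+ 2 * r (w * h) + w * r (w ^+ 2 * h)) * h ^+ 6) / 3); first by field.
by rewrite w4 w3 w2; field.
Qed.

(* At the points of L the value of wp is conventional; it happens to be 0 too. *)
Lemma wp_eisenstein_zero z : L (a * z) -> P z = 0.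
Proof.
move=> Laz.
have Lwz : L (w * z - z).
  have -> : w * z - z = (- w ^+ 2) * (a * z).
    have -> : (- w ^+ 2) * (a * z) = (- w ^+ 2 - 2 * w ^+ 3) * z by rewrite /a; ring.
    by rewrite w3 w2; ring.
  by apply: latticeM => //; apply: latticeN => //; rewrite expr2; apply: latticeM.
have := wpD rL z Lwz; rewrite addrC subrK wp_eisenstein => /eqP.
rewrite -subr_eq0 -{2}[P z]mul1r -mulrBl mulf_eq0 => /orP[|/eqP //].
rewrite subr_eq0 => /eqP w1; move/eqP: w2; rewrite w1 expr1n -subr_eq0 => /eqP e.
have /eqP : (3 : C) = 0 by rewrite -[RHS]e; ring.
by rewrite pnatr_eq0.
Qed.

Lemma wp_eisenstein_identity z : ~ L (a * z) ->
  3 * P (a * z) * P z ^+ 2 + P z ^+ 3 = 4 * P (1 / 2) ^+ 3.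
Proof.
move=> Laz.
have subL z' : ~ L (a * z') -> ~ L z' by move=> h /(latticeM rL La).
have a_half : a * (1 / 2) = 1 / 2 + w by rewrite /a; field.
have Lhalf : ~ L (a * (1 / 2)).
  by rewrite a_half addrC => /(latticeDl rL _ Lw); exact: lattice_half.
pose f z := 3 * P (a * z) * P z ^+ 2 + P z ^+ 3.
suff -> : 3 * P (a * z) * P z ^+ 2 + P z ^+ 3 = f (1 / 2).
  by rewrite /f a_half (wpD rL) //; ring.
rewrite -[LHS]/(f z); apply: (liouville_lattice rL (locally_finite_scale rL a0)) => //.
- move=> x l _ Ll; by rewrite /f (mulrDr a) (wpD rL _ Ll) (wpD rL _ (latticeM rL La Ll)).
- move=> z0; rewrite /f.
  have [Lz0|Lz0] := pselect (L z0).
    have [r br rE] := wp_reg_eisenstein; have bra := near0_bounded_scale a0 br.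
    (* Here P h = h^-2 + u h^4 and, as a^2 = - 3 and a^4 = 9, P (a h) = - h^-2 / 3 + 9 v h^4: the
       terms in h^-6 cancel. *)
    apply: (near0_bounded_eq (f := fun h => let u := r h in let v := r (a * h) in
       u + 2 * h ^+ 6 * u ^+ 2 + 27 * v + 54 * h ^+ 6 * u * v
       + 27 * h ^+ 12 * u ^+ 2 * v + h ^+ 12 * u ^+ 3)); last by cbv zeta; near0_bnd.
    move=> h h0 /=; rewrite (mulrDr a) [z0 + h]addrC [a * z0 + _]addrC.
    rewrite (wpD rL _ Lz0) (wpD rL _ (latticeM rL La Lz0)).
    rewrite !wp_pole ?mulf_neq0 // !rE !exprMn.
    have -> : a ^+ 4 = 9 by rewrite -[4%N]/(2 * 2)%N exprM a2; ring.
    rewrite a2; move: (r h) (r (a * h)) => u v; field.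
    by rewrite h0.
  have [Laz0|Laz0] := pselect (L (a * z0)).
    (* The zero of P, squared, absorbs the double pole of P (a z). *)
    have [k bk kE] := wp_simple_zero rL Lz0 (wp_eisenstein_zero Laz0).
    have bphi := near0_bounded_scale a0 (wp_reg_bounded rL).
    apply: (near0_bounded_eq (f := fun h => - k h ^+ 2
       + 3 * phi (a * h) * k h ^+ 2 * h ^+ 2 + k h ^+ 3 * h ^+ 3)); last by near0_bnd.
    move=> h h0 /=; rewrite (mulrDr a) [a * z0 + _]addrC (wpD rL _ Laz0) kE wp_pole ?mulf_neq0 //.
    by rewrite exprMn a2; field.
  have b1 := wp_bounded rL Lz0.
  have /expands_bounded b2 := wp_scale_expands rL 1 Laz0.
  by near0_bnd.
- move=> x Lx; rewrite /f.
  have e1 := wp_expands rL 3 (subL _ Lx).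
  have e2 := wp_scale_expands rL 3 Lx.
  by expnd.
Qed.

(** If P (1 / 2) were 0, the identity would carry zeros of P from a z to z, and [wp_neq0_of_scale]
    would then exclude the zero at 1 / 2 itself. *)
Lemma wp_eisenstein_half_neq0 : P (1 / 2) != 0.
Proof.
apply/eqP => e0.
have na : 1 < normc a.
  rewrite -(ltr_pXn2r (ltn0Sn 1)) ?nnegrE ?normc_ge0 // -normcX a2 normcN normc_nat.
  by rewrite expr1n; lra.
have := @wp_neq0_of_scale R L rL a La na.
move=> /(_ _ _ (lattice_half rL)); rewrite e0 eqxx => H.
suff : false by []; apply: H => z Lz Paz.
have := wp_eisenstein_identity Lz; rewrite Paz e0 mulr0 mul0r add0r expr0n mulr0.
by move/eqP; rewrite expf_eq0 => /andP[_ /eqP].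
Qed.

End EisensteinLattice.

(** * The Gaussian integers: multiplication by 1 + i, translation by t0, multiplication by 1 + 2
    i *)

Section GaussianLattice.
Variable R : realType.
Local Notation C := R[i].
Variables (L : set C) (rL : ring_lattice L) (j : C).
Hypotheses (Lj : L j) (j2 : j ^+ 2 = - 1).
Local Notation P := (wp L).
Local Notation phi := (wp_reg L).
Let E := P (1 / 2) ^+ 2.
(** The half period fixed by multiplication by j modulo L; as P (j z) = - P z, it is a zero of P. *)
Let t0 := (1 + j) / 2.

Let jj : j * j = -1.
Proof. by rewrite -expr2. Qed.

Let j0 : j != 0.
Proof. by apply/eqP => j0; move/eqP: j2; rewrite j0 expr0n eq_sym oppr_eq0 oner_eq0. Qed.

Let jV : j^-1 = - j.
Proof. by apply: (mulfI j0); rewrite divff // mulrN jj opprK. Qed.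

Let LjV : L j^-1.
Proof. by rewrite jV; exact: latticeN. Qed.

Let normj : normc j = 1.
Proof.
apply/eqP; rewrite -(eqrXn2 (ltn0Sn 1)) ?normc_ge0 //.
by rewrite -normcX j2 normcN normc1 expr1n.
Qed.

Let Lb : L (1 + j).
Proof. exact: latticeD (lattice_one rL) Lj. Qed.

Let b2 : (1 + j) ^+ 2 = 2 * j.
Proof. by rewrite sqrrD j2; ring. Qed.

Let b0 : 1 + j != 0.
Proof.
apply/eqP => b0; move/eqP: b2; rewrite b0 expr0n eq_sym mulf_eq0 (negbTE j0).
by rewrite pnatr_eq0.
Qed.

Let normb : normc (1 + j) ^+ 2 = 2.
Proof. by rewrite -normcX b2 normcM normc_nat normj mulr1. Qed.

Let normt0 : normc t0 ^+ 2 = 1 / 2.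
Proof. by rewrite /t0 normcM normcV normc_nat exprMn normb; field. Qed.

(** With these margins a point within 1/4 of t0 has modulus strictly between 0 and 1, hence is not
    in L. *)
Let t0_lt1 : normc t0 < 3 / 4 /\ 1 / 4 < normc t0.
Proof. by have := normt0; have := normc_ge0 t0; move: (normc t0) => x; split; nra. Qed.

Let t0_neq0 : t0 != 0.
Proof. by rewrite -normc_gt0; have [] := t0_lt1; lra. Qed.

Let Lt0 : ~ L t0.
Proof. by apply: (lattice_small rL) t0_neq0; have [] := t0_lt1; lra. Qed.

Let L2t0 : L (2 * t0).
Proof. by rewrite /t0 mulrC divfK // pnatr_eq0. Qed.

Lemma wp_gauss z : P (j * z) = - P z.
Proof. by rewrite (wp_unit rL) // j2 invrN invr1 mulrN1. Qed.

(** Since phi (j h) = - phi h, only exponents congruent to 2 modulo 4 survive. *)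
Lemma wp_reg_gauss : exists c r, near0_bounded r /\
  forall h, phi h = c * h ^+ 2 + r h * h ^+ 6.
Proof.
have phij h : phi (j * h) = - phi h by rewrite (wp_reg_unit rL) // j2 invrN invr1 mulrN1.
have [c2 [c4 [r [br rE]]]] := wp_reg_even6 rL.
have brj := near0_bounded_scale j0 br.
exists c2, (fun h => (r h + r (j * h)) / 2); split; first by near0_bnd.
move=> h; have -> : phi h = (phi h - phi (j * h)) / 2 by rewrite phij; field.
have j4 : j ^+ 4 = 1 by rewrite -[4%N]/(2 * 2)%N exprM j2; ring.
have j6 : j ^+ 6 = - 1 by rewrite -[6%N]/(2 * 3)%N exprM j2; ring.
by rewrite !rE ![(j * h) ^+ _]exprMn j2 j4 j6; field.
Qed.

Lemma wp_gauss_zero z : L ((1 + j) * z) -> P z = 0.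
Proof.
move=> Lz; have Ljz : L (j * z - z).
  have -> : j * z - z = j * ((1 + j) * z).
    by rewrite mulrDl mul1r mulrDr mulrA jj; ring.
  exact: latticeM.
have := wpD rL z Ljz; rewrite addrC subrK wp_gauss => /eqP.
by rewrite eq_sym -subr_eq0 opprK -mulr2n mulrn_eq0 => /eqP.
Qed.

Let double_lattice z : L ((1 + j) * z) -> L (2 * z).
Proof.
move=> Lz; have -> : 2 * z = (1 - j) * ((1 + j) * z).
  by rewrite mulrA -subr_sqr expr1n j2; ring.
by apply: latticeM => //; apply: latticeB => //; exact: lattice_one.
Qed.

Let Lbt0 : L ((1 + j) * t0).
Proof. by rewrite /t0 mulrA -expr2 b2 mulrAC divff ?mul1r // pnatr_eq0. Qed.

Let Pt0 : P t0 = 0.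
Proof. exact: wp_gauss_zero. Qed.

(** At L the terms in h^-4 cancel because b^2 = 2 j for b = 1 + j. At the other points of b^-1 L, 2
    z is a period, so P has a double zero against the double pole of P (b z). The constant is the
    value at 1 / 2, where b z = t0. *)
Lemma wp_gauss_duplication z : ~ L ((1 + j) * z) ->
  2 * j * P ((1 + j) * z) * P z = P z ^+ 2 - E.
Proof.
move=> Lbz; pose b := 1 + j; rewrite -/b in Lbz *.
have [Lb' b2' b0'] : [/\ L b, b ^+ 2 = 2 * j & b != 0] by [].
have subL x : ~ L (b * x) -> ~ L x by move=> h /(latticeM rL Lb').
pose f z := 2 * j * P (b * z) * P z - P z ^+ 2.
have b_half : b * (1 / 2) = t0 by rewrite /t0 -/b mulrA mulr1.
suff fz : f z = f (1 / 2).
  have := fz; rewrite /f b_half Pt0 mulr0 mul0r add0r -/E => <-; ring.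
have Lhalf : ~ L (b * (1 / 2)) by rewrite b_half.
apply: (liouville_lattice rL (locally_finite_scale rL b0')) => //.
- move=> x l _ Ll; by rewrite /f (mulrDr b) (wpD rL _ Ll) (wpD rL _ (latticeM rL Lb' Ll)).
- move=> z0; rewrite /f.
  have [Lz0|Lz0] := pselect (L z0).
    have [c [r [br rE]]] := wp_reg_gauss; have brb := near0_bounded_scale b0' br.
    (* u and v are defined by phi h = u h^2 and phi (b h) = v (b h)^2. *)
    apply: (near0_bounded_eq (f := fun h => let u := c + r h * h ^+ 4 in
       let v := c + r (b * h) * (b * h) ^+ 4 in
       u - 4 * v - 4 * h ^+ 4 * u * v - 2 * u - h ^+ 4 * u ^+ 2)).
      move=> h h0; cbv zeta; rewrite (mulrDr b) [z0 + h]addrC [b * z0 + _]addrC.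
      rewrite (wpD rL _ Lz0) (wpD rL _ (latticeM rL Lb' Lz0)).
      rewrite !wp_pole ?mulf_neq0 // !rE.
      set u := c + r h * h ^+ 4; set v := c + r (b * h) * _ ^+ 4.
      have -> : c * h ^+ 2 + r h * h ^+ 6 = u * h ^+ 2 by rewrite /u; ring.
      have -> : c * (b * h) ^+ 2 + r (b * h) * (b * h) ^+ 6 = v * (2 * j * h ^+ 2).
        by rewrite /v -b2'; ring.
      rewrite exprMn b2'; transitivity ((h ^- 2 + (2 * j) ^+ 2 * v * h ^+ 2) * (h ^- 2 + u * h ^+ 2)
        - (h ^- 2 + u * h ^+ 2) ^+ 2); last by field; rewrite h0 j0.
      by rewrite exprMn j2; field.
    by cbv zeta; near0_bnd.
  have [Lbz0|Lbz0] := pselect (L (b * z0)).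
    have [k bk kE] := wp_double_zero rL Lz0 (double_lattice Lbz0) (wp_gauss_zero Lbz0).
    have bphi := near0_bounded_scale b0' (wp_reg_bounded rL).
    apply: (near0_bounded_eq (f := fun h => (1 + 2 * j * phi (b * h) * h ^+ 2) * k h
       - k h ^+ 2 * h ^+ 4)); last by near0_bnd.
    move=> h h0 /=; rewrite (mulrDr b) [b * z0 + _]addrC (wpD rL _ Lbz0) kE wp_pole ?mulf_neq0 //.
    by rewrite exprMn b2'; field; rewrite h0 j0.
  have b1 := wp_bounded rL Lz0.
  have /expands_bounded b3 := wp_scale_expands rL 1 Lbz0.
  by near0_bnd.
- move=> x Lx; rewrite /f.
  have e1 := wp_expands rL 3 (subL _ Lx).
  have e2 := wp_scale_expands rL 3 Lx.
  by expnd.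
Qed.

Lemma wp_gauss_half_neq0 : E != 0.
Proof.
rewrite expf_eq0 /=; apply/eqP => e0.
have nb : 1 < normc (1 + j).
  by rewrite -(ltr_pXn2r (ltn0Sn 1)) ?nnegrE ?normc_ge0 // normb expr1n; lra.
have := @wp_neq0_of_scale R L rL (1 + j) Lb nb.
move=> /(_ _ _ (lattice_half rL)); rewrite e0 eqxx => H.
suff : false by []; apply: H => z Lz Pbz.
have := wp_gauss_duplication Lz; rewrite Pbz mulr0 mul0r /E e0 expr0n subr0.
by move/esym/eqP; rewrite expf_eq0 => /andP[_ /eqP].
Qed.

Let Lhalft0 : ~ L (1 / 2 + t0).
Proof.
have -> : 1 / 2 + t0 = j / 2 + 1 by rewrite /t0; field.
rewrite addrC => /(latticeDl rL _ (lattice_one rL)).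
apply: (lattice_small rL); last by rewrite mulf_neq0 // invr_eq0 pnatr_eq0.
by rewrite normcM normj mul1r normcV normc_nat; lra.
Qed.

Let Phalft0 : P (1 / 2 + t0) = - P (1 / 2).
Proof.
have -> : 1 / 2 + t0 = j * (1 / 2) + 1 by rewrite /t0; field.
by rewrite (wpD rL _ (lattice_one rL)) wp_gauss.
Qed.

Let zero_near_t0 z : L (z + t0) -> [/\ ~ L z, L (2 * z) & P z = 0].
Proof.
move=> Lz; split.
- by move=> /(latticeB rL Lz); rewrite addrC addKr.
- have -> : 2 * z = 2 * (z + t0) - 2 * t0 by ring.
  by apply: latticeB => //; apply: latticeM => //; exact: lattice_nat.
- by rewrite -(wpN rL) -(wpD rL _ Lz) addKr.
Qed.

Let double_zero_t0 : exists2 k, near0_bounded k & forall h, P (t0 + h) = k h * h ^+ 2.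
Proof. exact: wp_double_zero. Qed.

(** The double pole of each factor meets the double zero of the other; at 1 / 2 the factors are
    opposite, as 1 / 2 + t0 = j / 2 modulo L. *)
Lemma wp_gauss_translation z : ~ L z -> ~ L (z + t0) -> P (z + t0) * P z = - E.
Proof.
move=> Lz Lzt.
pose f z := P (z + t0) * P z; pose S z := L z \/ L (z + t0).
suff fz : f z = f (1 / 2) by have := fz; rewrite /f Phalft0 => ->; rewrite /E; ring.
have LL : locally_finite L by exact: lattice_finite.
apply: (liouville_lattice rL (locally_finiteU LL (locally_finite_shift rL t0))).
- move=> x l _ Ll; by rewrite /f (addrAC x l) !(wpD rL _ Ll).
- move=> z0; rewrite /f; have [k0 bk0 k0E] := double_zero_t0.
  have bphi := wp_reg_bounded rL.
  have [Lz0|Lz0] := pselect (L z0).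
    apply: (near0_bounded_eq (f := fun h => k0 h * (1 + phi h * h ^+ 2))); last by near0_bnd.
    move=> h h0; rewrite [z0 + h]addrC (addrAC h z0) !(wpD rL _ Lz0) addrC k0E wp_pole //.
    by field.
  have [Lz0t|Lz0t] := pselect (L (z0 + t0)).
    have [_ L2 P0] := zero_near_t0 Lz0t.
    have [k bk kE] := wp_double_zero rL Lz0 L2 P0.
    apply: (near0_bounded_eq (f := fun h => k h * (1 + phi h * h ^+ 2))); last by near0_bnd.
    move=> h h0; rewrite kE (addrAC z0 h) addrC (wpD rL _ Lz0t) wp_pole //.
    by field.
  have b1 := wp_bounded rL Lz0.
  have /expands_bounded b3 := wp_shift_expands rL 1 Lz0t.
  by near0_bnd.
- move=> x Sx; rewrite /f.
  have e1 : expands 3 P x by apply: wp_expands => // Lx; apply: Sx; left.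
  have e2 : expands 3 (fun z => P (z + t0)) x.
    by apply: wp_shift_expands => // Lx; apply: Sx; right.
  by expnd.
- by case.
- by case; [exact: lattice_half|exact: Lhalft0].
Qed.

Let a := 1 + 2 * j.

Let La : L a.
Proof. by apply: latticeD (lattice_one rL) _ => //; apply: latticeM => //; exact: lattice_nat. Qed.

Let aa : a * (1 - 2 * j) = 5.
Proof. by transitivity (1 - 4 * j ^+ 2); [rewrite /a; ring|rewrite j2; ring]. Qed.

Let a0 : a != 0.
Proof. by apply/eqP => a0; move/eqP: aa; rewrite a0 mul0r eq_sym pnatr_eq0. Qed.

Let at0 : a * t0 = t0 + (j - 1).
Proof.
have -> : a * t0 = t0 + (j + j * j) by rewrite /a /t0; field.
by rewrite jj.
Qed.

Let Lj1 : L (j - 1).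
Proof. by apply: latticeB => //; exact: lattice_one. Qed.

(** Since 1 + j = a - j, such a z satisfies (1 + j) z = - j z modulo L, and the duplication formula
    becomes an equation in P z alone. *)
Lemma wp_gauss_torsion z : ~ L z -> L (a * z) -> a * P z ^+ 2 = E.
Proof.
move=> Lz Laz.
have bz : (1 + j) * z = - (j * z) + a * z by rewrite /a; ring.
have Lbz : ~ L ((1 + j) * z).
  rewrite bz addrC => /(latticeDl rL _ Laz) /(latticeN rL); rewrite opprK => Ljz.
  by apply: Lz; rewrite -(mulKf j0 z); exact: latticeM.
have := wp_gauss_duplication Lbz; rewrite bz (wpD rL _ Laz) (wpN rL) wp_gauss => e.
have -> : a * P z ^+ 2 = P z ^+ 2 - 2 * j * - P z * P z by rewrite /a; ring.
by rewrite e; ring.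
Qed.

(** With P h = h^-2 + x h^2 + r h^6, P (a h) likewise with s, and P (t0 + h) = y h^2, this is the
    quintic function near 0 after the outer factors E are replaced by - P (t0 + h) P h. The terms in
    h^-10 cancel by themselves; c is the coefficient of h^-6 left over, and the factor h^2 absorbs
    h^-2. *)
Lemma quintic_pole_cancel (x y r s e h : C) : h != 0 ->
  let X := x + r * h ^+ 4 in let Y := a ^+ 4 * x + s * (a ^+ 8 * h ^+ 4) in
  let c := a ^+ 4 * x - x - 2 * e / a in
  let T := 2 * X + h ^+ 4 * X ^+ 2 - e / a in
  y * h ^+ 2 * (((a * h) ^- 2 + x * (a * h) ^+ 2 + s * (a * h) ^+ 6)
      * (a * (h ^- 2 + x * h ^+ 2 + r * h ^+ 6) ^+ 2 - e) ^+ 2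
    - (h ^- 2 + x * h ^+ 2 + r * h ^+ 6) ^+ 5
    - c * (h ^- 2 + x * h ^+ 2 + r * h ^+ 6) ^+ 3)
  = y * (a ^+ 8 * s - r + 2 * X ^+ 2 + 2 * Y * T + T ^+ 2 - 10 * X ^+ 2 - 3 * c * X
    + h ^+ 4 * (Y * T ^+ 2 - 10 * X ^+ 3 - 3 * c * X ^+ 2)
    - h ^+ 8 * (5 * X ^+ 4 + c * X ^+ 3) - h ^+ 12 * X ^+ 5).
Proof.
move=> h0; move: (a) a0 => A A0; cbv zeta.
by field; rewrite h0 A0.
Qed.

(** At this stage c involves the unevaluated coefficient of h^2 in P. *)
Lemma wp_gauss_quintic : exists c K : C, forall z, ~ L (a * z) -> ~ L (z + t0) ->
  P (a * z) * P (z + t0) * (a * P z ^+ 2 - E) ^+ 2 + E * P z ^+ 4 + c * E * P z ^+ 2 = K.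
Proof.
have [c2 [r [br rE]]] := wp_reg_gauss.
pose c := a ^+ 4 * c2 - c2 - 2 * E / a.
pose f z := P (a * z) * P (z + t0) * (a * P z ^+ 2 - E) ^+ 2 + E * P z ^+ 4 + c * E * P z ^+ 2.
exists c, (f (1 / 2)) => z Laz Lzt; rewrite -[LHS]/(f z).
have Lahalf : ~ L (a * (1 / 2)).
  have -> : a * (1 / 2) = 1 / 2 + j by rewrite /a; field.
  by rewrite addrC => /(latticeDl rL _ Lj); exact: lattice_half.
have subL x : ~ L (a * x) -> ~ L x by move=> h /(latticeM rL La).
apply: (liouville_lattice rL (locally_finiteU (locally_finite_scale rL a0) (locally_finite_shift rL t0))).
- move=> x l _ Ll; rewrite /f (addrAC x l) (mulrDr a) !(wpD rL _ Ll).
  by rewrite (wpD rL _ (latticeM rL La Ll)).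
- move=> z0; rewrite /f; have [k0 bk0 k0E] := double_zero_t0.
  have bphi := wp_reg_bounded rL; have bphia := near0_bounded_scale a0 bphi.
  have [Lz0|Lz0] := pselect (L z0).
    have bra := near0_bounded_scale a0 br.
    (* For |h| < 1/4, h <> 0, both h and h + t0 avoid L, so [wp_gauss_translation] can rewrite E as
       [quintic_pole_cancel] expects. *)
    apply: (near0_bounded_near (f := fun h =>
      let X := c2 + r h * h ^+ 4 in let Y := a ^+ 4 * c2 + r (a * h) * (a ^+ 8 * h ^+ 4) in
      let T := 2 * X + h ^+ 4 * X ^+ 2 - E / a in
      k0 h * (a ^+ 8 * r (a * h) - r h + 2 * X ^+ 2 + 2 * Y * T + T ^+ 2 - 10 * X ^+ 2 - 3 * c * X
       + h ^+ 4 * (Y * T ^+ 2 - 10 * X ^+ 3 - 3 * c * X ^+ 2)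
       - h ^+ 8 * (5 * X ^+ 4 + c * X ^+ 3) - h ^+ 12 * X ^+ 5)) (d := 1 / 4)); first by lra.
      move=> h h0 h4.
      have := quintic_pole_cancel c2 (k0 h) (r h) (r (a * h)) E h0.
      cbv zeta; rewrite -/c => <-.
      rewrite (mulrDr a) [z0 + h]addrC [a * z0 + _]addrC (addrAC h z0).
      rewrite !(wpD rL _ Lz0) (wpD rL _ (latticeM rL La Lz0)).
      have [t1 t2] := t0_lt1.
      have Lh : ~ L h by apply: (lattice_small rL) h0; lra.
      have Lht : ~ L (h + t0).
        apply: (lattice_small rL).
          by have := ler_normcD h t0; lra.
        by rewrite -normc_gt0; have := normc_triB t0 h; rewrite (addrC h t0); lra.
      have yE := wp_gauss_translation Lh Lht.
      have -> : k0 h * h ^+ 2 = P (h + t0) by rewrite addrC k0E.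
      have -> : (a * h) ^- 2 + c2 * (a * h) ^+ 2 + r (a * h) * (a * h) ^+ 6 = P (a * h).
        by rewrite wp_pole ?mulf_neq0 // rE addrA.
      have -> : h ^- 2 + c2 * h ^+ 2 + r h * h ^+ 6 = P h.
        by rewrite wp_pole // rE addrA.
      have -> : E = - (P (h + t0) * P h) by rewrite yE opprK.
      by ring.
    by cbv zeta; near0_bnd.
  (* Since a t0 = t0 modulo L, a z0 + t0 is in L as well, and the double zero of P (a z) absorbs the
     double pole of P (z + t0). *)
  have [Lz0t|Lz0t] := pselect (L (z0 + t0)).
    have [_ L2 _] := zero_near_t0 Lz0t.
    have Lazt : L (a * z0 + t0).
      have -> : a * z0 + t0 = a * (z0 + t0) - (j - 1) by rewrite mulrDr at0; ring.
      by apply: latticeB => //; exact: latticeM.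
    have [Laz0 L2a P0] := zero_near_t0 Lazt.
    have [k bk kE] := wp_double_zero rL Laz0 L2a P0.
    have bka := near0_bounded_scale a0 bk.
    have b1 := wp_bounded rL Lz0.
    apply: (near0_bounded_eq (f := fun h => k (a * h) * a ^+ 2 * (1 + phi h * h ^+ 2)
      * (a * P (z0 + h) ^+ 2 - E) ^+ 2 + E * P (z0 + h) ^+ 4 + c * E * P (z0 + h) ^+ 2));
      last by near0_bnd.
    move=> h h0; rewrite (mulrDr a) kE (addrAC z0 h) [z0 + t0 + h]addrC (wpD rL _ Lz0t).
    rewrite (wp_pole L h0); move: (P (z0 + h)) (k (a * h)) (phi h) => p q u.
    by field.
  have /expands_bounded b3 := wp_shift_expands rL 1 Lz0t.
  have b1 := wp_bounded rL Lz0.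
  (* By [wp_gauss_torsion], a P^2 - E vanishes at z0, so its square absorbs the double pole of P (a
     z). *)
  have [Laz0|Laz0] := pselect (L (a * z0)).
    have e1 : expands 1 (fun z => a * P z ^+ 2 - E) z0.
      by have e2 := wp_expands rL 1 Lz0; expnd.
    have [k [bk kE]] := expands1 e1.
    apply: (near0_bounded_eq (f := fun h => (a ^- 2 + phi (a * h) * h ^+ 2) * P (z0 + h + t0)
      * k h ^+ 2 + E * P (z0 + h) ^+ 4 + c * E * P (z0 + h) ^+ 2)); last by near0_bnd.
    move=> h h0; rewrite (mulrDr a) [a * z0 + _]addrC (wpD rL _ Laz0) kE.
    rewrite (wp_gauss_torsion Lz0 Laz0) subrr add0r (wp_pole L (mulf_neq0 a0 h0)).
    move: (P (z0 + h)) (P (z0 + h + t0)) (k h) (phi (a * h)) => p q u v.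
    by field; rewrite h0 a0.
  have /expands_bounded b4 := wp_scale_expands rL 1 Laz0.
  by near0_bnd.
- move=> x Sx; rewrite /f.
  have Lax : ~ L (a * x) by move=> Lx; apply: Sx; left.
  have e1 := wp_expands rL 3 (subL _ Lax).
  have e2 : expands 3 (fun z => P (z + t0)) x.
    by apply: wp_shift_expands => // Lx; apply: Sx; right.
  have e3 := wp_scale_expands rL 3 Lax.
  by expnd.
- by case.
- by case; [exact: Lahalf|exact: Lhalft0].
Qed.

(* The constant is found by letting z tend to the zero t0 of wp. *)
Lemma wp_gauss_quintic_cst c K : (forall z, ~ L (a * z) -> ~ L (z + t0) ->
  P (a * z) * P (z + t0) * (a * P z ^+ 2 - E) ^+ 2 + E * P z ^+ 4 + c * E * P z ^+ 2 = K) ->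
  K = - a ^+ 2 * E ^+ 3.
Proof.
move=> HK; apply/eqP; rewrite -subr_eq0 mulNr opprK; apply/eqP; apply: normc_cst_of_bound.
have [k bk kE] := double_zero_t0; have bka := near0_bounded_scale a0 bk.
have bphi := wp_reg_bounded rL; have bphia := near0_bounded_scale a0 bphi.
have na : 0 < normc a by rewrite normc_gt0.
have d0 : 0 < Num.min (1 / 4) (1 / 4 / normc a) by rewrite lt_min !divr_gt0.
(* The quotient (K + a^2 E^3) / h, computed at z = t0 + h. Its source is P (a z) P (z + t0) = a^2 k
   (a h) (1 + h^2 phi h), where k (a h) tends to - E, while (a P z^2 - E)^2 tends to E^2. *)
apply: (near0_bounded_near (f := fun h =>
  a ^+ 2 * (- k (a * h) * a ^+ 2 * phi (a * h) * E ^+ 2 + k (a * h) * phi h * E ^+ 2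
    + k (a * h) * (1 + h ^+ 2 * phi h) * h ^+ 2
      * (a ^+ 2 * k h ^+ 4 * h ^+ 4 - 2 * a * E * k h ^+ 2)) * h
  + E * k h ^+ 4 * h ^+ 7 + c * E * k h ^+ 2 * h ^+ 3) d0); last by near0_bnd.
move=> h h0; rewrite lt_min => /andP[h4 ha4].
have [t1 t2] := t0_lt1.
have small x : x != 0 -> normc x < 1 / 4 -> ~ L x.
  by move=> x0 x4; apply: (lattice_small rL) x0; lra.
have near_t0 x : normc x < 1 / 4 -> ~ L (x + t0).
  move=> x4; apply: (lattice_small rL).
    by have := ler_normcD x t0; lra.
  by rewrite -normc_gt0; have := normc_triB t0 x; rewrite (addrC x t0); lra.
have ah4 : normc (a * h) < 1 / 4 by rewrite normcM mulrC -ltr_pdivlMr.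
have ah0 : a * h != 0 by rewrite mulf_neq0.
have -> : K = P (a * (t0 + h)) * P (t0 + h + t0) * (a * P (t0 + h) ^+ 2 - E) ^+ 2
    + E * P (t0 + h) ^+ 4 + c * E * P (t0 + h) ^+ 2.
  rewrite HK //.
    rewrite mulrDr at0 addrAC addrC => /(latticeDl rL _ Lj1); rewrite addrC.
    exact: near_t0.
  have -> : t0 + h + t0 = 2 * t0 + h by ring.
  by move=> /(latticeDl rL _ L2t0); exact: small.
have -> : a * (t0 + h) = t0 + a * h + (j - 1) by rewrite mulrDr at0; ring.
rewrite (wpD rL _ Lj1).
have -> : t0 + h + t0 = h + 2 * t0 by ring.
rewrite (wpD rL _ L2t0) !kE.
(* The translation formula at a h, read as k (a h) = - E + O(h^2). *)
have kaE : k (a * h) = - E - k (a * h) * (a * h) ^+ 2 * phi (a * h).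
  have := wp_gauss_translation (small _ ah0 ah4) (near_t0 _ ah4).
  rewrite addrC kE (wp_pole L ah0) => e.
  have -> : - E = k (a * h) * (1 + (a * h) ^+ 2 * phi (a * h)).
    by rewrite -e; field; rewrite h0 a0.
  by ring.
rewrite (wp_pole L h0).
have EE : E = - k (a * h) - k (a * h) * (a * h) ^+ 2 * phi (a * h).
  by rewrite {1}kaE; ring.
transitivity ((a ^+ 2 * ((k (a * h) + E) * E ^+ 2 + k (a * h) * h ^+ 2 * phi h * E ^+ 2
    + k (a * h) * (1 + h ^+ 2 * phi h) * h ^+ 4
      * (a ^+ 2 * k h ^+ 4 * h ^+ 4 - 2 * a * E * k h ^+ 2))
  + E * k h ^+ 4 * h ^+ 8 + c * E * k h ^+ 2 * h ^+ 4) / h).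
  move: EE; move: (k h) (k (a * h)) (phi h) (phi (a * h)) E a => p q u v x A ->.
  by field.
move: (k h) (k (a * h)) (phi h) E a => p q u x A.
by field.
Qed.

(** Multiplying the quintic relation by - P z and using - P (z + t0) P z = E gives E times the
    claim. *)
Lemma wp_gauss_identity z : ~ L (a * z) -> ~ L (z + t0) ->
  P (a * z) * (a * P z ^+ 2 - E) ^+ 2 = P z * (P z ^+ 2 - a * E) ^+ 2.
Proof.
move=> Laz Lzt; have Lz : ~ L z by move=> /(latticeM rL La).
have [c [K HK]] := wp_gauss_quintic; have KE := wp_gauss_quintic_cst HK.
have E0 := wp_gauss_half_neq0.
(* The relation is read at 1 / 2, where a / 2 = 1 / 2 + j leaves P unchanged. *)
have cE : c = - 2 * a * E.
  have a_half : a * (1 / 2) = 1 / 2 + j by rewrite /a; field.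
  have := HK (1 / 2); rewrite a_half (wpD rL _ Lj) Phalft0 KE.
  have Lhj : ~ L (1 / 2 + j) by rewrite addrC => /(latticeDl rL _ Lj); exact: lattice_half.
  move=> /(_ Lhj Lhalft0).
  have -> : P (1 / 2) ^+ 4 = E ^+ 2 by rewrite /E; ring.
  have -> : P (1 / 2) * - P (1 / 2) = - E by rewrite /E; ring.
  rewrite -/E => e; apply: (mulfI (expf_neq0 2 E0)).
  have -> : E ^+ 2 * c = (- E * (a * E - E) ^+ 2 + E * E ^+ 2 + c * E * E)
      + E * (a * E - E) ^+ 2 - E ^+ 3 by ring.
  by rewrite e; ring.
have yE := wp_gauss_translation Lz Lzt.
have := HK z Laz Lzt; rewrite cE KE => e.
apply: (mulfI E0).
have -> : E * (P (a * z) * (a * P z ^+ 2 - E) ^+ 2) =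
   - (P (z + t0) * P z) * (P (a * z) * (a * P z ^+ 2 - E) ^+ 2) by rewrite yE opprK.
have -> : - (P (z + t0) * P z) * (P (a * z) * (a * P z ^+ 2 - E) ^+ 2) =
  - P z * ((P (a * z) * P (z + t0) * (a * P z ^+ 2 - E) ^+ 2 + E * P z ^+ 4
     + - 2 * a * E * E * P z ^+ 2) - E * P z ^+ 4 - - 2 * a * E * E * P z ^+ 2) by ring.
by rewrite e; ring.
Qed.

(* A zero of the denominator would make the numerator vanish too, which the two
   quadratic factors and E <> 0 forbid. *)
Lemma wp_gauss_denominator_neq0 z : ~ L (a * z) -> ~ L (z + t0) ->
  a * P z ^+ 2 - E != 0.
Proof.
move=> Laz Lzt; have E0 := wp_gauss_half_neq0; apply/eqP => D0.
have := wp_gauss_identity Laz Lzt; rewrite D0 expr0n mulr0 => /esym/eqP.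
have PE : a * P z ^+ 2 = E by apply/eqP; rewrite -subr_eq0 D0.
rewrite mulf_eq0 expf_eq0 /= => /orP[/eqP P0|].
  by move/eqP: E0; apply; rewrite -PE P0 expr0n mulr0.
(* A common zero of a P^2 - E and P^2 - a E would force a^2 = 1. *)
rewrite subr_eq0 => /eqP P2; move: PE; rewrite P2 mulrA => /eqP.
rewrite -subr_eq0 -{2}[E]mul1r -mulrBl mulf_eq0 (negbTE E0) orbF.
have -> : a * a - 1 = 4 * (j - 1).
  by transitivity (4 * j + 4 * j ^+ 2); [rewrite /a; ring|rewrite j2; ring].
rewrite mulf_eq0 pnatr_eq0 /= subr_eq0 => /eqP j1.
by move/eqP: j2; rewrite j1 expr1n -addr_eq0 -mulr2n pnatr_eq0.
Qed.

End GaussianLattice.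

(** * Meromorphy of z -> P (a z) *)

Section Meromorphic.
Variable R : realType.
Local Notation C := R[i].
Implicit Types (f g : C -> C) (z : C).

Lemma near_normc z (Q : C -> Prop) (d : R) : 0 < d ->
  (forall x, normc (x - z) < d -> Q x) -> \forall x \near (z : 'CC[R]), Q x.
Proof.
move=> d0 HQ; apply/(@nbhs_ballP _ 'CC[R]); exists d%:C; first by rewrite /= ltcR.
move=> x; rewrite -ball_normE /= => xz; apply: HQ.
by rewrite normc_dist -ltcR.
Qed.

Lemma near_normc_punctured z (Q : C -> Prop) (d : R) : 0 < d ->
  (forall x, x != z -> normc (x - z) < d -> Q x) -> \forall x \near (z : 'CC[R])^', Q x.
Proof.
move=> d0 HQ; rewrite /dnbhs /within /=; apply: near_normc d0 _ => x xd xz.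
exact: HQ.
Qed.

Lemma expands_derivable f z : expands 2 f z -> derivable (f : 'CC[R] -> 'CC[R]) z 1.
Proof.
move=> /expands2[b [r [/near0_bounded_ex[M [d [d0 M0 rM]]] fE]]].
apply: (cvgP (b : 'CC[R])); apply/cvgrPdist_lt => e e0.
have [er erE] : exists er : R, e = er%:C.
  by exists (complex.Re e); rewrite RRe_real // gtr0_real.
have er0 : 0 < er by rewrite -ltcR -erE.
have m0 : 0 < Num.min d (er / M) by rewrite lt_min d0 divr_gt0.
apply: (near_normc_punctured m0) => h h0.
rewrite subr0 lt_min ltr_pdivlMr // => /andP[hd hM].
have -> : h^-1 *: ((f : 'CC[R] -> 'CC[R]) (h *: (1 : 'CC[R]) + z) - f z) = b + r h * h.
  have -> : h *: (1 : 'CC[R]) + z = z + h by rewrite addrC /GRing.scale /= mulr1.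
  by rewrite fE /GRing.scale /=; field.
rewrite opprD addrA subrr sub0r normrc normcN erE ltcR normcM.
apply: le_lt_trans hM; rewrite mulrC ler_pM2l ?normc_gt0 //; exact: rM.
Qed.

Lemma locally_finite_isolated (S : C -> Prop) z : locally_finite S ->
  exists2 d : R, 0 < d & forall x, x != z -> normc (x - z) < d -> ~ S x.
Proof.
move=> lS; have [s sS] := lS (normc z + 1).
have [|d d0 ds] := @isolated_seq R [seq x <- s | x != z] z.
  by rewrite mem_filter eqxx.
exists (Num.min d 1); first by rewrite lt_min d0 ltr01.
move=> x xz; rewrite lt_min => /andP[xd x1] Sx.
have : x \in [seq x <- s | x != z].
  rewrite mem_filter xz sS //.
  by have := ler_normcD (x - z) z; rewrite subrK; lra.
by move=> /ds; rewrite leNgt xd.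
Qed.

Lemma meromorphic_near_eq (f g : 'CC[R] -> 'CC[R]) : meromorphic f ->
  (forall z : 'CC[R], \forall x \near z^', f x = g x) -> meromorphic g.
Proof.
move=> mf fg z0; have [n [h [hol fh]]] := mf z0; exists n, h; split=> //.
by apply: filterS2 fh (fg z0) => x -> <-.
Qed.

Lemma meromorphic_wp_scale (L : set C) a c : ring_lattice L -> L a -> a != 0 ->
  meromorphic (fun z : 'CC[R] => wp L (a * z) + c : 'CC[R]).
Proof.
move=> rL La a0 z0.
have [d d0 Hd] := locally_finite_isolated z0 (locally_finite_scale rL a0).
have [Lz0|Lz0] := pselect (L (a * z0)); last first.
  exists 0%N, (fun z => wp L (a * z) + c); split.
    apply: near_normc d0 _ => x xd; apply: expands_derivable.
    have Lx : ~ L (a * x) by have [->//|xz] := eqVneq x z0; exact: Hd.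
    by have e1 := wp_scale_expands rL 2 Lx; expnd.
  by apply: near_normc_punctured d0 _ => x _ _; rewrite expr0 divr1.
(* By periodicity this is (z - z0)^2 times the function, with the removable value at z0 filled
   in. *)
pose h z := a ^- 2 + (wp_reg L (a * z + - (a * z0)) + c) * (z - z0) ^+ 2.
exists 2%N, h; split.
  apply: near_normc d0 _ => x xd; apply: expands_derivable; rewrite /h.
  have e1 : expands 2 (fun z => wp_reg L (a * z + - (a * z0))) x.
    apply: expands_affine; apply: wp_reg_expands => // -[Lx x0].
    have xz : x != z0 by apply: contraNneq x0 => ->; rewrite subrr.
    apply: (Hd x xz xd); have := latticeD rL Lx Lz0; by rewrite subrK.
  by expnd.
apply: near_normc_punctured d0 _ => x xz xd; rewrite /h.
have xz0 : x - z0 != 0 by rewrite subr_eq0.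
have -> : a * x = a * (x - z0) + a * z0 by ring.
rewrite (wpD rL _ Lz0) wp_pole ?mulf_neq0 //.
have -> : a * (x - z0) + a * z0 - a * z0 = a * (x - z0) by ring.
by move: (wp_reg L (a * (x - z0))) (x - z0) xz0 => u v v0; field; rewrite v0 a0.
Qed.

End Meromorphic.

(** For t = 2 pi / 3, sin (3 t) = 0 with sin t > 0 gives 4 cos^2 t = 1, and cos (3 t) = 1 excludes
    cos t = 1 / 2. *)
Lemma cos_2pi3 (R : realType) : cos (2 * pi / 3 : R) = - 1 / 2.
Proof.
set t : R := 2 * pi / 3; pose c := cos t; pose s := sin t.
have p0 : 0 < (pi : R) by exact: pi_gt0.
have t0 : 0 < t by rewrite /t; lra.
have s0 : 0 < s by apply: sin_gt0_pi; rewrite t0 /t; lra.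
have cs : c ^+ 2 + s ^+ 2 = 1 by exact: cos2Dsin2.
have : sin (t + t + t) = 0.
  have -> : t + t + t = 0 + pi *+ 2 by rewrite /t mulr2n; lra.
  by rewrite sinD2pi sin0.
have : cos (t + t + t) = 1.
  have -> : t + t + t = pi *+ 2 by rewrite /t mulr2n; lra.
  exact: cos2pi.
rewrite !(sinD, cosD) -/c -/s => h1 h2.
have : s * (4 * c ^+ 2 - 1) = 0 by nra.
move=> /eqP; rewrite mulf_eq0 gt_eqF //= => /eqP h3.
have : (2 * c - 1) * (2 * c + 1) = 0 by nra.
move=> /eqP; rewrite mulf_eq0 => /orP[|] /eqP h4; last by rewrite -/c; lra.
have hc : c = 1 / 2 by lra.
move: h1 cs; rewrite hc => h1 cs; exfalso; lra.
Qed.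

(** * From the polynomial identities to the stated quotients *)

Section Multiplication.
Variable R : realType.
Local Notation C := R[i].

Lemma locally_finite_near (S : C -> Prop) (Q : C -> Prop) (z : C) : locally_finite S ->
  (forall x, ~ S x -> Q x) -> \forall x \near (z : 'CC[R])^', Q x.
Proof.
move=> lS SQ; have [d d0 Hd] := locally_finite_isolated z lS.
by apply: near_normc_punctured d0 _ => x xz xd; apply/SQ/Hd.
Qed.

(** The quotient g inherits meromorphy from f, with which it agrees off a locally finite set. *)
Lemma eq_meromorphic_wp_scale (L : set C) a c (S : C -> Prop) (f g : 'CC[R] -> 'CC[R]) :
  ring_lattice L -> L a -> a != 0 -> locally_finite S ->
  (forall z, f z = wp L (a * z) + c) -> (forall z, ~ S z -> f z = g z) ->
  eq_meromorphic f g.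
Proof.
move=> rL La a0 lS fE fg.
have mf : meromorphic f.
  apply: meromorphic_near_eq (meromorphic_wp_scale c rL La a0) _ => z.
  by near=> x; rewrite fE.
have fg' (z : 'CC[R]) : \forall x \near z^', f x = g x by exact: locally_finite_near lS fg.
by split=> //; exact: meromorphic_near_eq mf fg'.
Unshelve. all: by end_near. Qed.

Lemma cexp_2pi3 : cexp (2 * (pi%:C : 'CC[R]) * imagu R / 3)
  = (- 1 / 2) +i* sin (2 * pi / 3).
Proof.
have -> : 2 * (pi%:C : 'CC[R]) * imagu R / 3 = (0 +i* (2 * pi / 3) : C).
  have n3 : (3 : C) != 0 by rewrite pnatr_eq0.
  apply: (mulIf n3).
  have -> : (2 * (pi%:C : 'CC[R]) * imagu R / 3 : C) * 3 = 2 * pi%:C * imagu R.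
    by rewrite divfK.
  have -> : (3 : C) = (3 : R)%:C by rewrite rmorph_nat.
  have -> : (2 : C) = (2 : R)%:C by rewrite rmorph_nat.
  by apply/eqP; rewrite eq_complex /imagu /=; apply/andP; split; apply/eqP; field.
rewrite /cexp expR0 cos_2pi3; apply/eqP; rewrite eq_complex /=.
by apply/andP; split; apply/eqP; ring.
Qed.

Lemma lattice_tau (tau : 'CC[R]) : lattice 1 tau tau.
Proof. by exists 0 => //; exists 1 => //; rewrite mul0r add0r mul1r. Qed.

Lemma eisenstein_tau (w : C) : w = (- 1 / 2) +i* sin (2 * pi / 3) ->
  ring_lattice (lattice 1 (w : 'CC[R])) /\ w ^+ 2 = - 1 - w.
Proof.
move=> ->; set s := sin _.
have s2 : s ^+ 2 = 1 - true%:R / 4.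
  by have := cos2Dsin2 (2 * pi / 3 : R); rewrite cos_2pi3 -/s mulr1n; lra.
split; first exact: (@ring_lattice_quadratic R true).
by have := @tau_sqr R true (- 1 / 2 +i* s) erefl s2; rewrite mul1r.
Qed.

Lemma gauss_tau :
  ring_lattice (lattice 1 (imagu R)) /\ (imagu R : C) ^+ 2 = - 1.
Proof.
have re0 : complex.Re (imagu R) = - false%:R / 2 by rewrite /= oppr0 mul0r.
have im0 : complex.Im (imagu R) ^+ 2 = 1 - false%:R / 4 by rewrite /= expr1n mul0r subr0.
split; first exact: ring_lattice_quadratic re0 im0.
by have := tau_sqr re0 im0; rewrite mul0r subr0.
Qed.

Lemma eisenstein_multiplication (w : C) (P : C -> C) : P = wp (lattice 1 (w : 'CC[R])) ->
  ring_lattice (lattice 1 (w : 'CC[R])) -> w ^+ 2 = - 1 - w ->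
  eq_meromorphic
     (fun z : 'CC[R] => P ((1 + 2 * w) * z) - P (1 / 2) + (P (w / 2) - P (1 / 2)) / (w - 1))
     (fun z : 'CC[R] =>
        (4 * ((P (w / 2) - P (1 / 2)) / (w - 1)) ^+ 3
         - (P z - P (1 / 2) + (P (w / 2) - P (1 / 2)) / (w - 1)) ^+ 3)
        / (3 * (P z - P (1 / 2) + (P (w / 2) - P (1 / 2)) / (w - 1)) ^+ 2)).
Proof.
move=> PE rL w2; have Lw := lattice_tau (w : 'CC[R]).
have w1 : w - 1 != 0.
  rewrite subr_eq0; apply/eqP => w1; move: w2; rewrite w1 expr1n => /eqP.
  rewrite -subr_eq0 (_ : 1 - (- 1 - 1) = 3) ?pnatr_eq0 //; ring.
have Pw : P (w / 2) = w * P (1 / 2).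
  by rewrite PE -(wp_eisenstein rL Lw w2) mulrA mulr1.
(* Hence the shifts in the statement cancel: its left side is P (a z), and the shifted P z is P z
   itself. *)
have e_eq : (P (w / 2) - P (1 / 2)) / (w - 1) = P (1 / 2) by rewrite Pw; field.
have a2 : (1 + 2 * w) ^+ 2 = - 3.
  by transitivity (1 + 4 * w + 4 * w ^+ 2); [ring|rewrite w2; ring].
have a0 : 1 + 2 * w != 0.
  by apply/eqP => a0; move/eqP: a2; rewrite a0 expr0n eq_sym oppr_eq0 pnatr_eq0.
have La : lattice 1 (w : 'CC[R]) (1 + 2 * w).
  by apply: latticeD (lattice_one rL) _ => //; apply: latticeM => //; exact: lattice_nat.
apply: (eq_meromorphic_wp_scale (L := lattice 1 (w : 'CC[R])) (a := 1 + 2 * w) (c := 0)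
  rL La a0 (locally_finite_scale rL a0)).
  by move=> z; rewrite e_eq subrK addr0 PE.
move=> z Lz.
have := wp_eisenstein_identity rL Lw w2 Lz.
have := wp_eisenstein_half_neq0 rL Lw w2.
rewrite e_eq !subrK -PE => e0 id.
have Pz : P z != 0.
  apply: contraNneq e0 => Pz; move: id; rewrite Pz !expr0n mulr0 addr0 => /esym/eqP.
  by rewrite mulf_eq0 pnatr_eq0 expf_eq0 => /andP[].
by rewrite -id; field.
Qed.

Lemma gauss_multiplication (j : C) (P : C -> C) : P = wp (lattice 1 (j : 'CC[R])) ->
  ring_lattice (lattice 1 (j : 'CC[R])) -> j ^+ 2 = - 1 ->
  eq_meromorphic
     (fun z : 'CC[R] => P ((1 + 2 * j) * z))
     (fun z : 'CC[R] =>
        (-1 + 2 * j) ^+ 2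
        * (P z * (P z ^+ 2 - (1 + 2 * j) * P (j / 2) ^+ 2) ^+ 2
           / (5 * P z ^+ 2 - (1 - 2 * j) * P (j / 2) ^+ 2) ^+ 2)).
Proof.
move=> PE rL j2; have Lj := lattice_tau (j : 'CC[R]).
have Pj : P (j / 2) ^+ 2 = P (1 / 2) ^+ 2.
  have -> : j / 2 = j * (1 / 2) by rewrite mulrA mulr1.
  by rewrite PE (wp_gauss rL Lj j2) sqrrN.
(* This factors the denominator as (1 - 2 j)^2 (a P^2 - E)^2, and (-1 + 2 j)^2 cancels the first
   factor. *)
have aa : (1 - 2 * j) * (1 + 2 * j) = 5.
  by transitivity (1 - 4 * j ^+ 2); [ring|rewrite j2; ring].
have n5 : (5 : C) != 0 by rewrite pnatr_eq0.
have /andP[a'0 a0] : (1 - 2 * j != 0) && (1 + 2 * j != 0).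
  by rewrite -negb_or -mulf_eq0 aa.
have La : lattice 1 (j : 'CC[R]) (1 + 2 * j).
  by apply: latticeD (lattice_one rL) _ => //; apply: latticeM => //; exact: lattice_nat.
apply: (eq_meromorphic_wp_scale (L := lattice 1 (j : 'CC[R])) (a := 1 + 2 * j) (c := 0)
  rL La a0 (locally_finiteU (locally_finite_scale rL a0)
                            (locally_finite_shift rL ((1 + j) / 2)))).
  by move=> z; rewrite addr0 PE.
move=> z Sz.
have Laz : ~ lattice 1 (j : 'CC[R]) ((1 + 2 * j) * z) by move=> h; apply: Sz; left.
have Lzt : ~ lattice 1 (j : 'CC[R]) (z + (1 + j) / 2) by move=> h; apply: Sz; right.
have := wp_gauss_identity rL Lj j2 Laz Lzt.
have := wp_gauss_denominator_neq0 rL Lj j2 Laz Lzt.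
rewrite Pj -PE -aa.
move: (P ((1 + 2 * j) * z)) (P z) (P (1 / 2) ^+ 2) a'0 => y x e a'0 D0 id.
have -> : (1 - 2 * j) * (1 + 2 * j) * x ^+ 2 - (1 - 2 * j) * e
   = (1 - 2 * j) * ((1 + 2 * j) * x ^+ 2 - e) by ring.
have -> : -1 + 2 * j = - (1 - 2 * j) by ring.
rewrite -id; move: ((1 + 2 * j) * x ^+ 2 - e) D0 (1 - 2 * j) a'0 => D D0 A A0.
by field; rewrite A0 D0.
Qed.

End Multiplication.

Theorem mainTheorem7 (R : realType) :
  (let omega : 'CC[R] := cexp (2 * (pi%:C : 'CC[R]) * imagu R / 3) in
   let P : 'CC[R] -> 'CC[R] := wp (lattice 1 omega) in
   eq_meromorphic
     (fun z : 'CC[R] =>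
        P ((1 + 2 * omega) * z) - P (1 / 2)
        + (P (omega / 2) - P (1 / 2)) / (omega - 1))
     (fun z : 'CC[R] =>
        (4 * ((P (omega / 2) - P (1 / 2)) / (omega - 1)) ^+ 3
         - (P z - P (1 / 2) + (P (omega / 2) - P (1 / 2)) / (omega - 1)) ^+ 3)
        / (3 * (P z - P (1 / 2)
                + (P (omega / 2) - P (1 / 2)) / (omega - 1)) ^+ 2)))
  /\
  (let I : 'CC[R] := imagu R in
   let P : 'CC[R] -> 'CC[R] := wp (lattice 1 I) in
   eq_meromorphic
     (fun z : 'CC[R] => P ((1 + 2 * I) * z))
     (fun z : 'CC[R] =>
        (-1 + 2 * I) ^+ 2
        * (P z * (P z ^+ 2 - (1 + 2 * I) * P (I / 2) ^+ 2) ^+ 2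
           / (5 * P z ^+ 2 - (1 - 2 * I) * P (I / 2) ^+ 2) ^+ 2))).
Proof.
split.
  have [rL w2] := eisenstein_tau (cexp_2pi3 R).
  exact: eisenstein_multiplication erefl rL w2.
have [rL j2] := gauss_tau R.
exact: gauss_multiplication erefl rL j2.
Qed.
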